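(* There is a deterministic polynomial-time algorithm that, given a hedgegraph $G=(V,E)$, computes its partition connectivity $\mathrm{PC}_G$.
   Context: A hedgegraph $G=(V,E)$ consists of a finite vertex set $V$ and a finite set $E$ of hedges; each hedge $e\in E$ is a set of hyperedges (subsets of $V$), the hyperedges within one hedge are pairwise vertex-disjoint, and no hyperedge belongs to two different hedges. The input size is $p=\sum_{e\in E}\sum_{h\in e}|h|$. For a partition $\mathcal{P}$ of $V$ into nonempty parts, $\delta(\mathcal{P})$ is the set of hedges $e\in E$ containing some hyperedge $h\in e$ that intersects at least two parts of $\mathcal{P}$. The partition connectivity is $\mathrm{PC}_G=\min_{\mathcal{P}}\lfloor |\delta(\mathcal{P})|/(|\mathcal{P}|-1)\rfloor$, the minimum over partitions $\mathcal{P}$ of $V$ (with $0/0$ interpreted as $+\infty$, so the one-part partition does not contribute). *)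

(* Defs.v *)
From mathcomp Require Import all_boot.

Set Implicit Arguments.
Unset Strict Implicit.
Unset Printing Implicit Defensive.

(* Both constraints are instances of [trivIset] (distinct members are
   disjoint): at the level of vertices inside a hedge, and at the level of
   hyperedges across hedges. *)
Record hedgegraph (V : finType) := Hedgegraph {
  hedges : {set {set {set V}}};
  hyperedges_disjoint : forall e, e \in hedges -> trivIset e;
  hedges_disjoint : trivIset hedges
}.

Section PartitionConnectivity.
Variables (V : finType) (G : hedgegraph V).

Definition input_size : nat := \sum_(e in hedges G) \sum_(h in e) #|h|.

Definition crosses (P : {set {set V}}) (h : {set V}) : bool :=
  1 < #|[set B in P | h :&: B != set0]|.

Definition delta (P : {set {set V}}) : {set {set {set V}}} :=
  [set e in hedges G | [exists h in e, crosses P h]].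

(* Values in nat + {+oo}, with None standing for +oo.  The one-part partition
   gives 0/0 = +oo; so does the partition of an empty V into no parts, as
   subtraction is truncated. *)
Definition partition_ratio (P : {set {set V}}) : option nat :=
  if #|P| - 1 == 0 then None else Some (#|delta P| %/ (#|P| - 1)).

(* [oAC] extends minn to option nat with None as neutral element. *)
Definition partition_connectivity : option nat :=
  \big[oAC minnA minnC/None]_(P : {set {set V}} | partition P [set: V])
    partition_ratio P.

End PartitionConnectivity.

(* The random access machine of Cook and Reckhow (1973) with uniform cost, over
   the natural numbers: a fixed finite program, registers X_0, X_1, ..., a
   read-only input sequence and an append-only output sequence.  Since addition
   and truncated subtraction are the only arithmetic operations, register
   lengths grow by at most one bit per step, and polynomial time on this machine
   is polynomial time on Turing machines. *)
Inductive instr :=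
  | IConst (i c : nat)      (* X_i := c *)
  | IAdd (i j k : nat)      (* X_i := X_j + X_k *)
  | ISub (i j k : nat)      (* X_i := max (X_j - X_k) 0 *)
  | ILoad (i j : nat)       (* X_i := X_(X_j) *)
  | IStore (i j : nat)      (* X_(X_i) := X_j *)
  | IJumpPos (j l : nat)    (* if X_j > 0, go to instruction number l *)
  | IRead (i : nat)         (* X_i := next input word, or 0 if there is none *)
  | IPrint (i : nat).       (* append X_i to the output *)

Definition program := seq instr.

Record config := Config {
  pc : nat;
  reg : nat -> nat;
  input : seq nat;
  output : seq nat
}.

Definition set_reg (s : config) (i x : nat) : config :=
  Config (pc s).+1 [eta reg s with i |-> x] (input s) (output s).

Definition exec (c : instr) (s : config) : config :=
  match c with
  | IConst i c => set_reg s i c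
  | IAdd i j k => set_reg s i (reg s j + reg s k)
  | ISub i j k => set_reg s i (reg s j - reg s k)
  | ILoad i j => set_reg s i (reg s (reg s j))
  | IStore i j => set_reg s (reg s i) (reg s j)
  | IJumpPos j l =>
      Config (if 0 < reg s j then l else (pc s).+1)
             (reg s) (input s) (output s)
  | IRead i =>
      Config (pc s).+1 [eta reg s with i |-> head 0 (input s)]
             (behead (input s)) (output s)
  | IPrint i =>
      Config (pc s).+1 (reg s) (input s) (rcons (output s) (reg s i))
  end.

Definition halted (A : program) (s : config) : bool := size A <= pc s.

(* Halted configurations are fixed points of [step]. *)
Definition step (A : program) (s : config) : config :=
  if onth A (pc s) is Some c then exec c s else s.

Definition init (w : seq nat) : config := Config 0 (fun=> 0) w [::].

Definition computes_within (A : program) (w : seq nat) (t : nat)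
    (out : seq nat) : Prop :=
  let s := iter t (step A) (init w) in halted A s /\ output s = out.

(* Input format: a set is written as its cardinality followed by the codes of
   its elements in an arbitrary order, a vertex as its number in an arbitrary
   numbering nu of V by 0, ..., #|V| - 1, and a hedgegraph as #|V| followed by
   its set of hedges.  A hedgegraph thus has many codes. *)
Definition encodes_set (T : finType) (encT : T -> seq nat -> Prop)
    (A : {set T}) (w : seq nat) : Prop :=
  exists (s : seq T) (f : T -> seq nat),
    [/\ perm_eq s (enum A),
        forall x, x \in A -> encT x (f x)
      & w = size s :: flatten [seq f x | x <- s]].

Definition encodes_vertex (V : finType) (nu : V -> 'I_#|V|)
    (v : V) (w : seq nat) : Prop := w = [:: nu v : nat].

Definition encodes (V : finType) (G : hedgegraph V) (w : seq nat) : Prop :=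
  exists (nu : V -> 'I_#|V|) (u : seq nat),
    [/\ injective nu,
        encodes_set (encodes_set (encodes_set (encodes_vertex nu)))
          (hedges G) u
      & w = #|V| :: u].

Definition encode_value (x : option nat) : seq nat :=
  if x is Some k then [:: 1; k] else [:: 0].

(* Main.v *)
(* For a set A of hedges let c(A) be the number of components of A; then PC_G
   is the minimum of floor(|E \ A| / (c(A) - 1)) over the sets A with c(A) > 1.
   Repeat the following round: process the hedges by increasing load, and
   increase the load of each hedge by the number b_e of components that it
   merges; keep the least ratio [best] given by the prefixes A of the orders
   used. Every ratio is that of a partition, so that [best] >= PC_G.

   Conversely let k be the final value of [best], and suppose that
   |delta(P)| < k (|P| - 1) for some P. In every round the merges within the
   parts of P number at most |V| - |P|, so that the loads of the hedges of
   delta(P) grow by at least |P| - 1 in total: after t rounds the sum of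
   k L_e - t over delta(P) is at least t. On the other hand, every prefix A
   satisfies k (c(A) - 1) <= |E \ A|, and Abel summation along the order of the
   loads shows that the sum of the squares of the positive parts of k L_e - t
   increases by at most a polynomial D in every round. Hence t^2 <= |E| t D,
   which fails for t large. *)

Require Import Defs.
From mathcomp Require Import all_boot zify.

Set Implicit Arguments.
Unset Strict Implicit.
Unset Printing Implicit Defensive.

(** * A structured language for the random access machine *)

(** The function n - c(A) is submodular, and the vector (b_e) of a round is the base that Edmonds'
    greedy algorithm finds for the order of the loads: it minimizes the sum of L_e b_e over the base
    polytope. The rounds thus even out the loads without solving a linear program. Integrality makes
    this exact: if |delta(P)| >= k (|P| - 1) fails, it fails by at least 1, and this unit is gained
    in every round.

    The input size p does not bound |V|: vertices outside all hyperedges contribute nothing to p,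
    and |V| is a single input word. Hence no loop runs over the vertices: labels are stored only at
    endpoints of edges, and |V| serves as the initial number of components and to detect the trivial
    case. Nor does p see an empty hedge or an empty hyperedge, of which there is at most one each.

    The machine can neither multiply nor divide, and its programs are unstructured. The algorithm is
    therefore written in a language of counted loops: the polynomial degree is the nesting depth,
    once the counts are bounded polynomially in p. *)

Inductive array := VAR | EU | EV | EH | LAB | DONE | LOAD.

Definition offset (A : array) : nat :=
  match A with
  | VAR => 0 | EU => 1 | EV => 2 | EH => 3 | LAB => 4 | DONE => 5 | LOAD => 6
  end.

Inductive expr :=
  | Cst (c : nat)
  | Cell (A : array) (e : expr)
  | Plus (e1 e2 : expr)
  | Minus (e1 e2 : expr).

(** The count of a loop is evaluated once, on entry, so that every command terminates and its
    running time can be bounded by structural induction. *)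
Inductive cmd :=
  | Assign (A : array) (e1 e2 : expr)
  | Input (x : nat)
  | Output (e : expr)
  | Seq (c1 c2 : cmd)
  | Loop (e : expr) (c : cmd).

Record state := State {
  cells :> array -> nat -> nat;
  inp : seq nat;
  outp : seq nat
}.

Fixpoint value (M : array -> nat -> nat) (e : expr) : nat :=
  match e with
  | Cst c => c
  | Cell A e => M A (value M e)
  | Plus e1 e2 => value M e1 + value M e2
  | Minus e1 e2 => value M e1 - value M e2
  end.

(** Arrays are compared through their offsets, and with [eqn], so that simplification decides
    whether two concrete cells coincide. *)
Definition update (M : array -> nat -> nat) (A : array) (i x : nat) :=
  fun B j => if eqn (offset B) (offset A) && eqn j i then x else M B j.

Fixpoint eval (c : cmd) (s : state) : state :=
  match c with
  | Assign A e1 e2 =>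
      State (update s A (value s e1) (value s e2)) (inp s) (outp s)
  | Input x => State (update s VAR x (head 0 (inp s))) (behead (inp s)) (outp s)
  | Output e => State s (inp s) (rcons (outp s) (value s e))
  | Seq c1 c2 => eval c2 (eval c1 s)
  | Loop e c => iter (value s e) (eval c) s
  end.

(* The arrays and the temporaries of the compiler are interleaved modulo 8, so
   that they never overlap, whatever their lengths. *)
Definition addr (A : array) (i : nat) : nat := 8 * i + offset A.
Definition tmp (d : nat) : nat := 8 * d + 7.

Definition compile_addr (d : nat) (A : array) : seq instr :=
  [:: IAdd (tmp d) (tmp d) (tmp d); IAdd (tmp d) (tmp d) (tmp d);
      IAdd (tmp d) (tmp d) (tmp d); IConst (tmp d.+1) (offset A);
      IAdd (tmp d) (tmp d) (tmp d.+1)].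

Fixpoint compile_expr (d : nat) (e : expr) : seq instr :=
  match e with
  | Cst c => [:: IConst (tmp d) c]
  | Cell A e => compile_expr d e ++ compile_addr d A ++ [:: ILoad (tmp d) (tmp d)]
  | Plus e1 e2 => compile_expr d e1 ++ compile_expr d.+1 e2 ++
                 [:: IAdd (tmp d) (tmp d) (tmp d.+1)]
  | Minus e1 e2 => compile_expr d e1 ++ compile_expr d.+1 e2 ++
                 [:: ISub (tmp d) (tmp d) (tmp d.+1)]
  end.

(** The temporaries below [tmp d] are in use by the enclosing loops, and [a] is the address of the
    code, as jump targets are absolute. The counter of a loop stays in [tmp d] while its body runs
    at depth [d.+1]; an unconditional jump tests a register just set to 1. *)
Fixpoint compile (d a : nat) (c : cmd) : seq instr :=
  match c with
  | Assign A e1 e2 =>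
      compile_expr d e1 ++ compile_addr d A ++ compile_expr d.+1 e2 ++
      [:: IStore (tmp d) (tmp d.+1)]
  | Input x => [:: IRead (addr VAR x)]
  | Output e => compile_expr d e ++ [:: IPrint (tmp d)]
  | Seq c1 c2 =>
      let p1 := compile d a c1 in p1 ++ compile d (a + size p1) c2
  | Loop e c =>
      let l := a + size (compile_expr d e) in
      let p := compile d.+1 (l + 3) c in
      compile_expr d e ++
      [:: IJumpPos (tmp d) (l + 3); IConst (tmp d.+1) 1;
          IJumpPos (tmp d.+1) (l + 3 + size p + 3)] ++
      p ++
      [:: IConst (tmp d.+1) 1; ISub (tmp d) (tmp d) (tmp d.+1);
          IJumpPos (tmp d.+1) l]
  end.

Fixpoint loops_bounded (N : nat) (c : cmd) (s : state) : Prop :=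
  match c with
  | Seq c1 c2 => loops_bounded N c1 s /\ loops_bounded N c2 (eval c1 s)
  | Loop e c =>
      value s e <= N /\
      forall i, i < value s e -> loops_bounded N c (iter i (eval c) s)
  | _ => True
  end.

(** Here [N] bounds all loop counts. An iteration costs 4 instructions besides the body: the test,
    then the decrement in two instructions and the jump back. Leaving the loop costs 3. *)
Fixpoint time_bound (N : nat) (c : cmd) : nat :=
  match c with
  | Seq c1 c2 => time_bound N c1 + time_bound N c2
  | Loop e c => size (compile_expr 0 e) + 3 + N * (time_bound N c + 4)
  | _ => size (compile 0 0 c)
  end.

Fixpoint depth (c : cmd) : nat :=
  match c with
  | Seq c1 c2 => maxn (depth c1) (depth c2)
  | Loop _ c => (depth c).+1
  | _ => 0
  end.

Fixpoint weight (c : cmd) : nat :=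
  match c with
  | Seq c1 c2 => weight c1 + weight c2
  | Loop e c => size (compile_expr 0 e) + 7 + weight c
  | _ => size (compile 0 0 c)
  end.

Lemma time_bound_le N c : time_bound N c <= weight c * N.+1 ^ depth c.
Proof.
elim: c => [A e1 e2|x|e|c1 IH1 c2 IH2|e c IH] /=; rewrite ?expn0 ?muln1 //.
  rewrite mulnDl; apply: leq_add; [apply: leq_trans IH1 _|apply: leq_trans IH2 _];
    by rewrite leq_mul2l leq_pexp2l ?orbT // ?leq_maxl ?leq_maxr.
rewrite expnS; set X := N.+1 ^ depth c in IH *.
have X0 : 0 < X by rewrite expn_gt0.
move: (size _) (weight c) (time_bound N c) IH => a b t IH.
apply: (@leq_trans (a + 3 + N * (b * X + 4))).
  by rewrite leq_add2l leq_mul2l leq_add2r IH orbT.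
nia.
Qed.

Lemma size_compile_expr d e : size (compile_expr d e) = size (compile_expr 0 e).
Proof.
elim: e d => [c|A e IH|e1 IH1 e2 IH2|e1 IH1 e2 IH2] d //=;
  rewrite !size_cat /= ?IH ?IH1 //; by rewrite (IH2 d.+1) (IH2 1).
Qed.

Lemma tmp_eq d d' : (tmp d == tmp d') = (d == d').
Proof. by rewrite /tmp; apply/eqP/eqP; lia. Qed.

Lemma addr_tmp B j d : (addr B j == tmp d) = false.
Proof. by apply/eqP; rewrite /addr /tmp; case: B => /=; lia. Qed.

Lemma tmp_addr B j d : (tmp d == addr B j) = false.
Proof. by rewrite eq_sym addr_tmp. Qed.

Lemma addr_eq B i C j : (addr B i == addr C j) = (eqn (offset B) (offset C) && eqn i j).
Proof.
apply/eqP/andP => [|[/eqnP + /eqnP ->]]; last by rewrite /addr => ->.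
by move=> h; split; apply/eqnP; move: h; rewrite /addr; case: B; case: C => /=; lia.
Qed.

Definition sets_registers (c : instr) : bool :=
  match c with IJumpPos _ _ | IRead _ | IPrint _ => false | _ => true end.

Definition effect (r : nat -> nat) (c : instr) : nat -> nat :=
  reg (exec c (Config 0 r [::] [::])).

(** * Correctness and cost of the compiled code *)

Section Compiler.
Variable A : program.

Definition code_at (C : seq instr) (a : nat) : Prop :=
  exists pre post, A = pre ++ C ++ post /\ size pre = a.

Lemma code_at_cat C1 C2 a :
  code_at (C1 ++ C2) a -> code_at C1 a /\ code_at C2 (a + size C1).
Proof.
case=> pre [post] [defA <-]; rewrite /code_at defA; split.
  by exists pre, (C2 ++ post); rewrite -catA.
by exists (pre ++ C1), post; rewrite size_cat -!catA.
Qed.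

Lemma code_at_cons c C a :
  code_at (c :: C) a -> onth A a = Some c /\ code_at C a.+1.
Proof.
rewrite -cat1s => /code_at_cat [[pre [post] [defA <-]]]; rewrite addn1; split=> //.
by rewrite defA onth_cat ltnn subnn.
Qed.

Definition runs (t : nat) (s s' : config) : Prop := iter t (step A) s = s'.

Lemma runs_trans t1 t2 s1 s2 s3 :
  runs t1 s1 s2 -> runs t2 s2 s3 -> runs (t1 + t2) s1 s3.
Proof. by rewrite /runs addnC iterD => -> ->. Qed.

Lemma runs1 a c r i o : onth A a = Some c ->
  runs 1 (Config a r i o) (exec c (Config a r i o)).
Proof. by rewrite /runs /= /step /= => ->. Qed.

Lemma runs_straight C a r i o : code_at C a -> all sets_registers C ->
  runs (size C) (Config a r i o) (Config (a + size C) (foldl effect r C) i o).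
Proof.
elim: C a r => [|c C IH] a r /=; first by rewrite addn0.
move=> /code_at_cons [/runs1 h1 /IH h2] /andP [hc hC].
rewrite -add1n; apply: runs_trans (h1 _ _ _) _.
have -> : exec c (Config a r i o) = Config a.+1 (effect r c) i o by case: c hc {h1}.
by rewrite addnA addn1; apply: h2.
Qed.

(** The temporaries below [d] hold the loop counters and partial results of the enclosing code. *)
Definition preserves (d : nat) (r r' : nat -> nat) : Prop :=
  forall d', d' < d -> r' (tmp d') = r (tmp d').

Definition represents (r : nat -> nat) (M : array -> nat -> nat) : Prop :=
  forall B j, r (addr B j) = M B j.

Lemma represents_tmp r M d x :
  represents r M -> represents [eta r with tmp d |-> x] M.
Proof. by move=> rM B j; rewrite -rM /= addr_tmp. Qed.

Lemma preserves_tmp r d x : preserves d r [eta r with tmp d |-> x].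
Proof. by move=> d' lt_d /=; rewrite tmp_eq ltn_eqF. Qed.

Lemma preserves_trans d r1 r2 r3 :
  preserves d r1 r2 -> preserves d r2 r3 -> preserves d r1 r3.
Proof. by move=> h1 h2 d' lt_d; rewrite h2 // h1. Qed.

Lemma preservesW d d' r r' : d <= d' -> preserves d' r r' -> preserves d r r'.
Proof. by move=> le_d h e lt_e; apply: h; apply: leq_trans le_d. Qed.

Lemma compile_addr_ok M B d a r i o :
  code_at (compile_addr d B) a -> represents r M ->
  exists r', [/\ runs 5 (Config a r i o) (Config (a + 5) r' i o),
    represents r' M, preserves d r r' & r' (tmp d) = addr B (r (tmp d))].
Proof.
move=> hC rM; exists (foldl effect r (compile_addr d B)); split.
- exact: (runs_straight _ _ _ hC).
- by rewrite /=; do 5 apply: represents_tmp.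
- move=> d' lt_d; rewrite /effect /= !tmp_eq (ltn_eqF lt_d).
  by rewrite (ltn_eqF (leqW lt_d)).
- by rewrite /effect /= !tmp_eq !eqxx (ltn_eqF (ltnSn d)) /addr; lia.
Qed.

Lemma compile_expr_ok M e d a r i o :
  code_at (compile_expr d e) a -> represents r M ->
  exists r', [/\ runs (size (compile_expr d e)) (Config a r i o)
                   (Config (a + size (compile_expr d e)) r' i o),
    represents r' M, preserves d r r' & r' (tmp d) = value M e].
Proof.
elim: e d a r => [c|B e IH|e1 IH1 e2 IH2|e1 IH1 e2 IH2] d a r.
- move=> hC rM; exists (foldl effect r (compile_expr d (Cst c))); split.
  + exact: (runs_straight _ _ _ hC).
  + exact: represents_tmp.
  + exact: preserves_tmp.
  + by rewrite /effect /= eqxx.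
- move=> /code_at_cat [/IH {}IH /code_at_cat [hA hL]] rM.
  have [r1 [x1 rM1 p1 v1]] := IH _ rM.
  have [r2 [x2 rM2 p2 v2]] := compile_addr_ok i o hA rM1.
  have x3 := runs_straight r2 i o hL isT.
  eexists; split.
  + by rewrite !size_cat !addnA; apply: runs_trans x3; apply: runs_trans x2.
  + exact: represents_tmp.
  + exact: preserves_trans (preserves_trans p1 p2) (preserves_tmp _ _).
  + by rewrite /effect /= eqxx v2 rM2 v1.
- move=> /code_at_cat [/IH1 {}IH1 /code_at_cat [/IH2 {}IH2 hL]] rM.
  have [r1 [x1 rM1 p1 v1]] := IH1 _ rM.
  have [r2 [x2 rM2 p2 v2]] := IH2 _ rM1.
  have x3 := runs_straight r2 i o hL isT.
  eexists; split.
  + by rewrite !size_cat !addnA; apply: runs_trans x3; apply: runs_trans x2.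
  + exact: represents_tmp.
  + apply: preserves_trans (preserves_tmp _ _).
    exact: preserves_trans p1 (preservesW (leqnSn d) p2).
  + by rewrite /effect /= eqxx v2 (p2 d) // v1.
- move=> /code_at_cat [/IH1 {}IH1 /code_at_cat [/IH2 {}IH2 hL]] rM.
  have [r1 [x1 rM1 p1 v1]] := IH1 _ rM.
  have [r2 [x2 rM2 p2 v2]] := IH2 _ rM1.
  have x3 := runs_straight r2 i o hL isT.
  eexists; split.
  + by rewrite !size_cat !addnA; apply: runs_trans x3; apply: runs_trans x2.
  + exact: represents_tmp.
  + apply: preserves_trans (preserves_tmp _ _).
    exact: preserves_trans p1 (preservesW (leqnSn d) p2).
  + by rewrite /effect /= eqxx v2 (p2 d) // v1.
Qed.

Lemma compile_ok N c d a (s : state) r :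
  code_at (compile d a c) a -> represents r s -> loops_bounded N c s ->
  exists t r', [/\ t <= time_bound N c,
    runs t (Config a r (inp s) (outp s))
      (Config (a + size (compile d a c)) r' (inp (eval c s)) (outp (eval c s))),
    represents r' (cells (eval c s)) & preserves d r r'].
Proof.
elim: c d a s r => [B e1 e2|x|e|c1 IH1 c2 IH2|e c IH] d a s r.
- move=> /code_at_cat [hE1 /code_at_cat [hB /code_at_cat [hE2 hL]]] rs _.
  have [r1 [x1 rs1 p1 v1]] := compile_expr_ok (inp s) (outp s) hE1 rs.
  have [r2 [x2 rs2 p2 v2]] := compile_addr_ok (inp s) (outp s) hB rs1.
  have [r3 [x3 rs3 p3 v3]] := compile_expr_ok (inp s) (outp s) hE2 rs2.
  have x4 := runs_straight r3 (inp s) (outp s) hL isT.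
  have x := runs_trans (runs_trans (runs_trans x1 x2) x3) x4.
  exists (size (compile_expr d e1) + 5 + size (compile_expr d.+1 e2) + 1).
  eexists; split.
  + rewrite [time_bound _ _]/= !size_cat -/compile_expr.
    rewrite (size_compile_expr d) (size_compile_expr d.+1) /= size_cat.
    by rewrite (size_compile_expr 1) /=; lia.
  + have -> : a + size (compile d a (Assign B e1 e2)) =
        a + size (compile_expr d e1) + 5 + size (compile_expr d.+1 e2) + 1.
      by rewrite /= size_cat /= size_cat /=; lia.
    exact: x.
  + rewrite /effect /= p3 // v2 v1 v3 => C j /=.
    by rewrite addr_eq /update rs3.
  + apply: preserves_trans (preserves_trans p1 p2) _.
    apply: preserves_trans (preservesW (leqnSn d) p3) _ => d' lt_d; rewrite /effect /=.
    by rewrite p3 // v2 tmp_addr.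
- move=> /code_at_cons [h _] rs _; have x1 := runs1 r (inp s) (outp s) h.
  exists 1; eexists; split; [by [] | by rewrite addn1; apply: x1 | |] => /=.
  + by move=> C j /=; rewrite addr_eq /update rs.
  + by move=> d' lt_d /=; rewrite tmp_addr.
- move=> /code_at_cat [hE /code_at_cons [h _]] rs _.
  have [r1 [x1 rs1 p1 v1]] := compile_expr_ok (inp s) (outp s) hE rs.
  have x := runs_trans x1 (runs1 r1 (inp s) (outp s) h).
  exists (size (compile_expr d e) + 1), r1; split=> //.
  + by rewrite /= size_cat (size_compile_expr d).
  + rewrite /= v1 in x; rewrite [compile _ _ _]/= size_cat [size [:: _]]/= addnA.
    by rewrite [in Config (_ + 1)]addn1; apply: x.
- move=> /code_at_cat [hc1 hc2] rs [b1 b2].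
  have [t1 [r1 [le1 x1 rs1 p1]]] := IH1 _ _ _ _ hc1 rs b1.
  have [t2 [r2 [le2 x2 rs2 p2]]] := IH2 _ _ _ _ hc2 rs1 b2.
  exists (t1 + t2), r2; split=> //; first exact: leq_add.
  + by rewrite /= size_cat addnA; apply: runs_trans x2.
  + exact: preserves_trans p2.
- rewrite [compile _ _ _]/=; set l := a + _; set p := compile _ _ c.
  set fin := l + 3 + size p + 3.
  move=> /code_at_cat [hE /code_at_cons [h1 /code_at_cons [h2 /code_at_cons [h3]]]].
  rewrite -/l in h1 h2 h3 *; rewrite -[l.+3]addn3 => /code_at_cat [hp hL].
  have {hL} [hL /code_at_cons [h6 _]] := @code_at_cat [:: _; _] [:: _] _ hL.
  move=> rs [leN bc].
  have [r0 [x0 rs0 p0 v0]] := compile_expr_ok (inp s) (outp s) hE rs.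
  set n := value s e in leN bc v0 *.
  (* After [k] iterations the machine is back at the test, with [n - k] in the counter. *)
  have loop k : k <= n -> exists t r',
      [/\ t <= size (compile_expr 0 e) + k * (time_bound N c + 4),
          runs t (Config a r (inp s) (outp s))
            (Config l r' (inp (iter k (eval c) s)) (outp (iter k (eval c) s))),
          represents r' (iter k (eval c) s), preserves d r r'
        & r' (tmp d) = n - k].
    elim: k => [|k IHk] lt_k.
      exists (size (compile_expr d e)), r0; split=> //; rewrite ?subn0 //.
      by rewrite (size_compile_expr d) mul0n addn0.
    have [t [r1 [le_t x1 rs1 p1 v1]]] := IHk (ltnW lt_k).
    move: (runs1 r1 (inp (iter k (eval c) s)) (outp (iter k (eval c) s)) h1).
    rewrite /= v1 subn_gt0 lt_k => y1.
    have [t2 [r2 [le2 x2 rs2 p2]]] := IH _ _ _ _ hp rs1 (bc _ lt_k).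
    rewrite -/p -iterS in x2 rs2.
    have x3 := runs_straight r2 (inp (iter k.+1 (eval c) s))
                 (outp (iter k.+1 (eval c) s)) hL isT.
    set r3 := foldl _ _ _ in x3.
    have x4 := runs1 r3 (inp (iter k.+1 (eval c) s))
                 (outp (iter k.+1 (eval c) s)) h6.
    have d1d : (tmp d.+1 == tmp d) = false by rewrite tmp_eq gtn_eqF.
    have dd1 : (tmp d == tmp d.+1) = false by rewrite eq_sym.
    have r31 : r3 (tmp d.+1) = 1 by rewrite /r3 /effect /= ?d1d ?eqxx.
    rewrite /= r31 /= in x4.
    have := runs_trans (runs_trans (runs_trans (runs_trans x1 y1) x2) x3) x4.
    exists (t + 1 + t2 + 2 + 1), r3; split=> //.
    + by rewrite mulSn; lia.
    + by do 2 apply: represents_tmp.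
    + apply: preserves_trans p1 _; apply: preserves_trans (preservesW _ p2) _ => //.
      apply: preserves_trans (preserves_tmp _ _).
      exact: preservesW (preserves_tmp _ _).
    + by rewrite /r3 /effect /= !eqxx dd1 p2 // v1; lia.
  have [t [r1 [le_t x1 rs1 p1 v1]]] := loop n (leqnn n).
  rewrite subnn in v1.
  set s' := iter n (eval c) s in x1 rs1 *.
  have := runs1 r1 (inp s') (outp s') h1; rewrite /= v1 => x2.
  have := runs1 r1 (inp s') (outp s') h2; rewrite /= => x3.
  have := runs1 [eta r1 with tmp d.+1 |-> 1] (inp s') (outp s') h3; rewrite /= eqxx => x4.
  exists (t + 1 + 1 + 1), [eta r1 with tmp d.+1 |-> 1]; split.
  + apply: (@leq_trans (size (compile_expr 0 e) + 3 + n * (time_bound N c + 4))).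
      by lia.
    by rewrite leq_add2l leq_mul2r leN orbT.
  + have -> : a + size (compile d a (Loop e c)) = fin.
      by rewrite /= size_cat /= size_cat /fin /p /l /=; lia.
    exact: runs_trans (runs_trans (runs_trans x1 x2) x3) x4.
  + exact: represents_tmp.
  + apply: preserves_trans p1 _; apply: preservesW (preserves_tmp _ _); exact: leqnSn.
Qed.
End Compiler.

Definition start (w : seq nat) : state := State (fun _ => fun=> 0) w [::].

Lemma computes_within_leq A w t t' out :
  t <= t' -> computes_within A w t out -> computes_within A w t' out.
Proof.
move=> /subnK <-; rewrite /computes_within iterD.
set s := iter t _ _ => -[hs ho].
suff -> : iter (t' - t) (step A) s = s by [].
elim: (t' - t) => //= k ->; rewrite /step; case E: (onth A (pc s)) => [i|] //.
by move: hs; rewrite /halted -onthNE E.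
Qed.

Lemma compile_program c N w :
  loops_bounded N c (start w) ->
  computes_within (compile 0 0 c) w (weight c * N.+1 ^ depth c)
    (outp (eval c (start w))).
Proof.
move=> bN; set A := compile 0 0 c.
have hA : code_at A A 0 by exists [::], [::]; rewrite cats0.
have r0 : represents (fun=> 0) (start w) by [].
have [t [r [le_t x _ _]]] := compile_ok hA r0 bN.
apply: computes_within_leq (leq_trans le_t (time_bound_le N c)) _.
rewrite /runs /= in x; rewrite /computes_within /init x.
by split; first by rewrite /halted /=.
Qed.

(** * Components and the potential argument *)

(** A partition of the vertices is given by a labeling, and this is its number of parts. Labels have
    any type, since the parts of a partition, and pairs of a label and a part, also serve as
    labels. *)
Definition classes (T : eqType) (n : nat) (f : nat -> T) : nat :=
  size (undup [seq f x | x <- iota 0 n]).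

Definition cut (T : eqType) (f : nat -> T) (es : seq (nat * nat)) : bool :=
  has (fun uv => f uv.1 != f uv.2) es.

Definition relabel (f : nat -> nat) (a b x : nat) : nat :=
  if f x == a then b else f x.

Lemma mem_classes (T : eqType) n (f : nat -> T) u :
  u < n -> f u \in undup [seq f x | x <- iota 0 n].
Proof. by move=> lt_u; rewrite mem_undup map_f // mem_iota. Qed.

Lemma classes_comp (T S : eqType) n (f : nat -> T) (g : T -> S) u v :
  u < n -> v < n ->
  classes n (g \o f) + ((f u != f v) && (g (f u) == g (f v))) <= classes n f.
Proof.
move=> lt_u lt_v; set s := undup [seq f x | x <- iota 0 n].
have sub : {subset undup [seq (g \o f) x | x <- iota 0 n] <= [seq g x | x <- s]}.
  move=> y; rewrite mem_undup => /mapP [x]; rewrite mem_iota => /andP [_ lt_x] ->.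
  by rewrite /= map_f ?mem_classes.
case: (boolP (_ && _)) => [/andP [/eqP neq /eqP eqg]|_]; last first.
  rewrite addn0 /classes -/s -(size_map g s); apply: uniq_leq_size sub; exact: undup_uniq.
have us : u \in iota 0 n by rewrite mem_iota.
rewrite addn1 /classes -/s (perm_size (perm_to_rem (mem_classes f lt_u))) -/s /=.
rewrite ltnS -(size_map g); apply: uniq_leq_size; first exact: undup_uniq.
move=> y /sub /mapP [z zs ->]; case: (eqVneq z (f u)) => [->|nz].
  rewrite eqg map_f // mem_rem_uniq ?undup_uniq // inE mem_classes // andbT.
  by rewrite eq_sym; apply/eqP.
by rewrite map_f // mem_rem_uniq ?undup_uniq // inE nz.
Qed.

Lemma classes_relabel n f u v : u < n -> v < n -> f u != f v ->
  (classes n (relabel f (f u) (f v))).+1 = classes n f.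
Proof.
move=> lt_u lt_v neq; rewrite /classes.
set s' := undup _; set s := undup [seq f x | x <- _].
suff /perm_size <- : perm_eq (f u :: s') s by [].
apply: uniq_perm; rewrite ?undup_uniq //=.
  rewrite undup_uniq andbT mem_undup; apply/negP => /mapP [x _]; rewrite /relabel.
  by case: eqP => [_ e|ne e]; [rewrite e eqxx in neq|apply: ne].
move=> y; rewrite inE !mem_undup; apply/orP/idP => [[/eqP -> | /mapP [x xs ->]]|].
- by rewrite -mem_undup mem_classes.
- by rewrite /relabel; case: ifP => _; rewrite map_f // mem_iota.
case/mapP=> x xs ->; case: (eqVneq (f x) (f u)) => [-> | ne]; first by left.
by right; apply/mapP; exists x => //; rewrite /relabel (negbTE ne).
Qed.

(* The pairs (label, part of g) are merged by every edge inside a part, while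
   their number stays at least the number of parts: this bounds the number of
   merges inside the parts. *)
Lemma classes_pair_relabel (T : eqType) n f (g : nat -> T) u v :
  u < n -> v < n -> f u != f v ->
  classes n (fun x => (relabel f (f u) (f v) x, g x)) + (g u == g v)
    <= classes n (fun x => (f x, g x)).
Proof.
move=> lt_u lt_v neq.
have := @classes_comp _ _ n (fun x => (f x, g x))
  (fun p => (if p.1 == f u then f v else p.1, p.2)) u v lt_u lt_v.
rewrite /= !xpair_eqE negb_and neq eqxx if_same eqxx /=.
by apply: leq_trans; rewrite leq_add2l.
Qed.

Lemma classes_le_pair (T : eqType) n (f : nat -> nat) (g : nat -> T) :
  0 < n -> classes n g <= classes n (fun x => (f x, g x)).
Proof.
move=> n0; have := @classes_comp _ _ n (fun x => (f x, g x)) snd 0 0 n0 n0.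
by apply: leq_trans; rewrite leq_addr.
Qed.

Lemma classes_gt0 (T : eqType) n (f : nat -> T) : 0 < n -> 0 < classes n f.
Proof. by move=> /(mem_classes f); rewrite /classes; case: undup. Qed.

Lemma classes_le (T : eqType) n (f : nat -> T) : classes n f <= n.
Proof. by rewrite /classes -[leqRHS](size_iota 0) -(size_map f) size_undup. Qed.

Lemma classes_inj (T : eqType) n (f : nat -> T) : {in gtn n &, injective f} ->
  classes n f = n.
Proof.
move=> inj; rewrite /classes undup_id ?size_map ?size_iota //.
rewrite map_inj_in_uniq ?iota_uniq // => x y; rewrite !mem_iota; exact: inj.
Qed.

(** * Abel summation and the quadratic potential *)

Lemma sorted_weighted_sum (phi d : nat -> nat) (s : seq nat) :
  sorted (relpre phi leq) s ->
  (forall s1 s2, s = s1 ++ s2 -> \sum_(j <- s2) d j <= size s2) ->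
  \sum_(j <- s) phi j * d j <= \sum_(j <- s) phi j.
Proof.
move=> sort_s suf.
(* Abel summation, by induction with a lower bound [a] of the values: passing the head [x] raises
   [a] to [phi x], and the slice of height [phi x - a] is paid for by the hypothesis on the whole
   current suffix, where [d] has average at most 1. *)
suff H a : all (fun j => a <= phi j) s ->
    \sum_(j <- s) (phi j - a) * d j <= \sum_(j <- s) (phi j - a).
  have := H 0; rewrite all_predT => /(_ isT).
  by under eq_bigr do rewrite subn0; under [leqRHS]eq_bigr do rewrite subn0.
elim: s a sort_s suf => [|x s IH] a; first by rewrite !big_nil.
rewrite /= => sort_s suf /andP [le_a _].
have all_x : all (fun j => phi x <= phi j) s.
  by apply: order_path_min sort_s => ? ? ?; apply: leq_trans.
have {}IH := IH (phi x) (path_sorted sort_s) (fun s1 s2 e =>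
  suf (x :: s1) s2 (congr1 (cons x) e)) all_x.
have := suf [::] _ erefl; rewrite /= big_cons => sufx.
rewrite !big_cons.
have split j : j \in s -> phi j - a = (phi j - phi x) + (phi x - a).
  by move/(allP all_x) => ?; lia.
rewrite big_seq [X in _ <= _ + X]big_seq.
under eq_bigr => j /split -> do rewrite mulnDl.
under [X in _ <= _ + X]eq_bigr => j /split -> do [].
rewrite -!big_seq !big_split /= -big_distrr /=.
have -> : \sum_(j <- s) (phi x - a) = (phi x - a) * size s.
  by rewrite -sum1_size big_distrr; apply: eq_bigr => *; rewrite /= muln1.
nia.
Qed.

(** With y the positive part of k L_j - t and b = k B_j, the new square is at most y^2 + 2 y (b - 1)
    + (b - 1)^2. The last term is at most [W], and the middle terms sum to at most 0 by Abel
    summation, the suffixes of [o] having the largest loads. *)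
Lemma potential_step (L B : nat -> nat) (o : seq nat) (m k t W : nat) :
  perm_eq o (iota 0 m) -> sorted (relpre L leq) o ->
  (forall s1 s2, o = s1 ++ s2 -> k * \sum_(j <- s2) B j <= size s2) ->
  (forall j, (k * B j) ^ 2 + 1 <= W) ->
  \sum_(j <- iota 0 m) (k * (L j + B j) - t.+1) ^ 2
    <= \sum_(j <- iota 0 m) (k * L j - t) ^ 2 + m * W.
Proof.
move=> perm_o sort_o suf le_W.
have abel := @sorted_weighted_sum (fun j => k * L j - t) (fun j => k * B j) o.
have {}abel : \sum_(j <- o) (k * L j - t) * (k * B j) <= \sum_(j <- o) (k * L j - t).
  apply: abel => [|s1 s2 /suf]; last by rewrite big_distrr.
  apply: sub_sorted sort_o => x y /= le_xy; rewrite leq_sub2r // leq_mul2l le_xy.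
  by rewrite orbT.
rewrite -!(perm_big _ perm_o) /=.
have -> : m * W = \sum_(j <- o) W.
  rewrite -[m](size_iota 0) -(perm_size perm_o) -sum1_size big_distrl /=.
  by apply: eq_bigr => *; rewrite mul1n.
(* The term 2 y moves to the left, so that the possibly negative 2 y (b - 1) does not meet truncated
   subtraction. *)
rewrite -(leq_add2r (\sum_(j <- o) 2 * (k * L j - t))).
apply: (@leq_trans (\sum_(j <- o) ((k * L j - t) ^ 2 + W +
    2 * ((k * L j - t) * (k * B j))))).
  rewrite -big_split /=; apply: leq_sum => j _; have := le_W j.
  rewrite mulnDr.
  set b := k * B j; have : k * L j + b - t.+1 <= (k * L j - t) + b - 1 by lia.
  move: (k * L j + b - t.+1) (k * L j - t) => x y; rewrite -!mulnn => le_x h.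
  have : x * x <= (y + b - 1) * (y + b - 1) by apply: leq_mul.
  case: (posnP (y + b)) => [/eqP|yb].
    by rewrite addn_eq0 => /andP [/eqP -> /eqP ->]; lia.
  have [z ez] : exists z, y + b = z.+1 by exists (y + b).-1; lia.
  by have -> : y + b - 1 = z by [lia]; nia.
by rewrite !big_split /= leq_add2l big1_eq !addn0 leq_add.
Qed.

(** The positive parts phi_j of k L_j - T, for T = Z^6, sum to at least T over [D]. With c = m Z^4,
    summing 2 c phi_j <= phi_j^2 + c^2 gives 2 c T <= T c + m c^2, that is T <= m^2 Z^4, against m <
    Z. The exponent 6 is thus 4 for the growth of the potential and 2 for m^2. *)
Lemma potential_contradiction (L : nat -> nat) (D : pred nat) (m k Z : nat) :
  m < Z ->
  \sum_(j <- iota 0 m) (k * L j - Z ^ 6) ^ 2 <= Z ^ 6 * (m * Z ^ 4) ->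
  Z ^ 6 * (count D (iota 0 m)).+1 <= \sum_(j <- iota 0 m | D j) k * L j ->
  False.
Proof.
move=> lt_mZ; set T := Z ^ 6; set W := Z ^ 4 => le_pot le_cut.
have Z0 : 0 < Z by apply: leq_ltn_trans lt_mZ.
have W0 : 0 < W by rewrite expn_gt0 Z0.
pose phi j := k * L j - T; set c := m * W.
have le_T : T <= \sum_(j <- iota 0 m | D j) phi j.
  rewrite -(leq_add2r (T * count D (iota 0 m))) -mulnS.
  apply: leq_trans le_cut _; rewrite -sum1_count big_distrr -big_split /=.
  by apply: leq_sum => j _; rewrite /phi; lia.
have sq j : 2 * c * phi j <= phi j ^ 2 + c ^ 2.
  by rewrite -mulnA [c * _]mulnC; case: (nat_Cauchy (phi j) c).
have : 2 * c * T <= \sum_(j <- iota 0 m) (phi j ^ 2 + c ^ 2).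
  apply: (@leq_trans (\sum_(j <- iota 0 m | D j) 2 * c * phi j)).
    by rewrite -big_distrr leq_mul2l le_T orbT.
  rewrite [leqRHS](bigID D) /=; apply: leq_trans (leq_addr _ _).
  by apply: leq_sum => j _; apply: sq.
have -> : \sum_(j <- iota 0 m) (phi j ^ 2 + c ^ 2) =
    \sum_(j <- iota 0 m) phi j ^ 2 + m * c ^ 2.
  rewrite big_split; congr (_ + _) => /=.
  rewrite -[in RHS](size_iota 0 m) -sum1_size big_distrl.
  by apply: eq_bigr => *; rewrite /= mul1n.
have eT : T = Z * Z * W by rewrite mulnn -expnD.
have [m0|m_gt0] := posnP m.
  by move: le_T; rewrite m0 big_nil eT; nia.
move=> h; have {le_pot} := leq_trans h (leq_add le_pot (leqnn _)).
rewrite -/c => h2; have : c * T <= m * c ^ 2 by nia.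
rewrite eT -mulnn => h3.
have : c * (Z * Z * W) <= c * (m * m * W).
  by apply: leq_trans h3 _; rewrite /c; lia.
have c0 : 0 < c by rewrite muln_gt0 m_gt0.
by rewrite (leq_pmul2l c0) (leq_pmul2r W0) leqNgt ltn_mul.
Qed.

(** * The program *)

Local Notation "c1 ;; c2" := (Seq c1 c2) (at level 61, right associativity).
Definition var (x : nat) : expr := Cell VAR (Cst x).
Definition set_var (x : nat) (e : expr) : cmd := Assign VAR (Cst x) e.
Definition incr (x : nat) : cmd := set_var x (Plus (var x) (Cst 1)).
(* Subtraction is truncated: the body runs once if e > 0 and never otherwise. *)
Definition When (e : expr) (c : cmd) : cmd := Loop (Minus (Cst 1) (Minus (Cst 1) e)) c.
Definition dist (e1 e2 : expr) : expr := Plus (Minus e1 e2) (Minus e2 e1).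

(** This and [keeps_var] are syntactic frame conditions: they are decided by computation, so that
    unchanged cells call for no reasoning about the execution. *)
Fixpoint keeps_array (A : array) (c : cmd) : bool :=
  match c with
  | Assign B _ _ => ~~ eqn (offset A) (offset B)
  | Input _ => ~~ eqn (offset A) (offset VAR)
  | Output _ => true
  | Seq c1 c2 => keeps_array A c1 && keeps_array A c2
  | Loop _ c => keeps_array A c
  end.

Fixpoint keeps_var (x : nat) (c : cmd) : bool :=
  match c with
  | Assign VAR (Cst y) _ | Input y => ~~ eqn x y
  | Assign VAR _ _ => false
  | Seq c1 c2 => keeps_var x c1 && keeps_var x c2
  | Loop _ c => keeps_var x c
  | _ => true
  end.

(** A syntactic criterion for [loops_bounded]: every count is a variable of [F], which the command
    must keep, or has the form 1 - e of [When]. *)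
Fixpoint loops_over (F : seq nat) (c : cmd) : bool :=
  match c with
  | Seq c1 c2 => loops_over F c1 && loops_over F c2
  | Loop e c =>
      (match e with
       | Cell VAR (Cst x) => x \in F
       | Minus (Cst 1) _ => true
       | _ => false
       end) && loops_over F c
  | _ => true
  end.

Lemma iter_ind (I : nat -> state -> Prop) n f s :
  I 0 s -> (forall i, i < n -> I i (iter i f s) -> I i.+1 (f (iter i f s))) ->
  I n (iter n f s).
Proof.
move=> I0 IS; suff H i : i <= n -> I i (iter i f s) by apply: H.
by elim: i => // i IH lt_i; apply: IS => //; apply/IH/ltnW.
Qed.

Lemma iter_keeps A x (f : state -> state) (s : state) n :
  (forall t : state, f t A x = t A x) -> iter n f s A x = s A x.
Proof. by move=> h; elim: n => //= n <-. Qed.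

Lemma keeps_arrayP A c (s : state) x : keeps_array A c -> eval c s A x = s A x.
Proof.
elim: c s => [B e1 e2|y|e|c1 IH1 c2 IH2|e c IH] s /=.
- by rewrite /update => /negbTE ->.
- by rewrite /update => /negbTE ->.
- by [].
- by case/andP=> k1 k2; rewrite IH2 // IH1.
- by move=> k; apply: iter_keeps => t; apply: IH.
Qed.

Lemma keeps_varP c (s : state) x : keeps_var x c -> eval c s VAR x = s VAR x.
Proof.
elim: c s => [B e1 e2|y|e|c1 IH1 c2 IH2|e c IH] s /=.
- by case: B => //; case: e1 => //= y; rewrite /update /= => /negbTE ->.
- by rewrite /update => /= /negbTE ->.
- by [].
- by case/andP=> k1 k2; rewrite IH2 // IH1.
- by move=> k; apply: iter_keeps => t; apply: IH.
Qed.

Lemma loops_overP N F c (s : state) :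
  loops_over F c -> all (fun x => keeps_var x c) F -> 0 < N ->
  (forall x, x \in F -> s VAR x <= N) -> loops_bounded N c s.
Proof.
move=> + + N0; elim: c s => // [c1 IH1 c2 IH2|e c IH] s /=.
  case/andP=> l1 l2 /allP k le_N; split.
    by apply: IH1 => //; apply/allP => x /k /andP [].
  apply: IH2 => // [|x xF]; first by apply/allP => x /k /andP [].
  by rewrite keeps_varP ?le_N //; case/andP: (k x xF).
case/andP=> le l k le_N; split.
  case: e le => // [[]|[[|[|]]|||] e] //= => [[] // x /le_N //|_].
  by apply: leq_trans N0; exact: leq_subr.
move=> i _; apply: IH => // x xF.
rewrite iter_keeps ?le_N // => t; apply: keeps_varP; exact: (allP k).
Qed.

Lemma eval_When e c s : eval (When e c) s = if 0 < value s e then eval c s else s.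
Proof. by rewrite /When /=; case: (value s e) => [|[]]. Qed.

Lemma eval_Loop e c s : eval (Loop e c) s = iter (value s e) (eval c) s.
Proof. by []. Qed.

Lemma eval_Seq c1 c2 s : eval (c1 ;; c2) s = eval c2 (eval c1 s).
Proof. by []. Qed.

Lemma eval_Assign A e1 e2 s : eval (Assign A e1 e2) s =
  State (update s A (value s e1) (value s e2)) (inp s) (outp s).
Proof. by []. Qed.

Lemma eval_set_var x e s : eval (set_var x e) s =
  State (update s VAR x (value s e)) (inp s) (outp s).
Proof. by []. Qed.

Lemma eval_incr x s : eval (incr x) s =
  State (update s VAR x (s VAR x + 1)) (inp s) (outp s).
Proof. by []. Qed.

Definition evalE := (eval_Seq, eval_Assign, eval_set_var, eval_incr).

Lemma dist_eq0 (s : state) e1 e2 : (0 < value s (dist e1 e2)) = (value s e1 != value s e2).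
Proof. by rewrite /=; apply/idP/idP; lia. Qed.

Arguments eval : simpl never.
Arguments update M A i x B j /.

(** The counters of vertices, hedges and edges are [xn], [xm], [xM]; [xc] and [xrem] count
    components and unprocessed hedges; [xe] is the current hedge, [xa] and [xb] are the labels being
    merged. In a division [xd], [xx], [xq] are the divisor, the remainder and the quotient. *)
Local Notation xn := 0 (only parsing).
Local Notation xm := 1 (only parsing).
Local Notation xM := 2 (only parsing).
Local Notation xZ := 3 (only parsing).
Local Notation xbest := 4 (only parsing).
Local Notation xc := 5 (only parsing).
Local Notation xrem := 6 (only parsing).
Local Notation xj := 7 (only parsing).
Local Notation xe := 8 (only parsing).
Local Notation xa := 9 (only parsing).
Local Notation xb := 10 (only parsing).
Local Notation xl := 11 (only parsing).
Local Notation xq := 12 (only parsing).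
Local Notation xx := 13 (only parsing).
Local Notation xd := 14 (only parsing).
Local Notation xh := 15 (only parsing).
Local Notation xu := 16 (only parsing).
Local Notation xv := 17 (only parsing).
Local Notation xr := 18 (only parsing).

(** [xu] holds the first vertex of the hyperedge, the center of its star; [xM] and [xh] count from
    0, the initial value of every cell. *)
Definition parse_edge : cmd :=
  Input xv ;; Assign EU (var xM) (var xu) ;; Assign EV (var xM) (var xv) ;;
  Assign EH (var xM) (var xh) ;; incr xM.
Definition parse_hyperedge : cmd :=
  Input xr ;; When (var xr) (Input xu ;; Loop (Minus (var xr) (Cst 1)) parse_edge).
Definition parse_hedge : cmd :=
  Input xq ;; Loop (var xq) parse_hyperedge ;; incr xh.
Definition parse : cmd :=
  Input xn ;; Input xm ;; Loop (var xm) parse_hedge.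

(** Repeated subtraction; as [xrem] is at most [xm] and the divisor is positive, [xm] attempts are
    enough. *)
Definition divide : cmd :=
  set_var xq (Cst 0) ;; set_var xx (var xrem) ;;
  Loop (var xm)
    (When (Minus (Plus (var xx) (Cst 1)) (var xd))
      (set_var xx (Minus (var xx) (var xd)) ;; incr xq)).
Definition check : cmd :=
  set_var xd (Minus (var xc) (Cst 1)) ;;
  When (var xd)
    (divide ;; When (Minus (var xbest) (var xq)) (set_var xbest (var xq))).

Definition clear_labels : cmd :=
  set_var xj (Cst 0) ;;
  Loop (var xM)
    (Assign LAB (Cell EU (var xj)) (Cell EU (var xj)) ;;
     Assign LAB (Cell EV (var xj)) (Cell EV (var xj)) ;;
     incr xj).
Definition clear_done : cmd :=
  set_var xj (Cst 0) ;;
  Loop (var xm) (Assign DONE (var xj) (Cst 0) ;; incr xj).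

(* Finds an unprocessed hedge of minimum load: j replaces e if j is unprocessed
   and e is processed or has a larger load. *)
Definition select : cmd :=
  set_var xe (Cst 0) ;; set_var xj (Cst 0) ;;
  Loop (var xm)
    (When (Minus (Cst 1) (Cell DONE (var xj)))
       (When (Plus (Cell DONE (var xe))
                (Minus (Cell LOAD (var xe)) (Cell LOAD (var xj))))
          (set_var xe (var xj))) ;;
     incr xj).

Definition relabel_cell (i : expr) : cmd :=
  When (Minus (Cst 1) (dist (Cell LAB i) (var xa))) (Assign LAB i (var xb)).
Definition merge_labels : cmd :=
  set_var xl (Cst 0) ;;
  Loop (var xM)
    (relabel_cell (Cell EU (var xl)) ;; relabel_cell (Cell EV (var xl)) ;; incr xl).

Definition process_edge : cmd :=
  set_var xa (Cell LAB (Cell EU (var xj))) ;;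
  set_var xb (Cell LAB (Cell EV (var xj))) ;;
  When (dist (var xa) (var xb))
    (merge_labels ;; set_var xc (Minus (var xc) (Cst 1)) ;;
     Assign LOAD (var xe) (Plus (Cell LOAD (var xe)) (Cst 1))).
Definition process : cmd :=
  set_var xj (Cst 0) ;;
  Loop (var xM)
    (When (Minus (Cst 1) (dist (Cell EH (var xj)) (var xe))) process_edge ;; incr xj).

Definition process_next : cmd :=
  select ;; process ;; Assign DONE (var xe) (Cst 1) ;;
  set_var xrem (Minus (var xrem) (Cst 1)) ;; check.
Definition round : cmd :=
  set_var xc (var xn) ;; set_var xrem (var xm) ;; clear_labels ;; clear_done ;;
  check ;; Loop (var xm) process_next.

(** Nesting makes up for the missing multiplication: the body is run Z^k times. *)
Fixpoint nested (k : nat) (c : cmd) : cmd :=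
  if k is k'.+1 then Loop (var xZ) (nested k' c) else c.

(* Z^6 rounds suffice for Z > |E| + the number of edges. *)
Definition optimize : cmd :=
  set_var xbest (var xm) ;; set_var xZ (Plus (Plus (var xm) (var xM)) (Cst 2)) ;;
  nested 6 round.

(** The first word 1 - (2 - n) is 1 for n >= 2 and 0 otherwise: the value is +oo exactly when there
    is at most one vertex. *)
Definition program_text : cmd :=
  parse ;; Output (Minus (Cst 1) (Minus (Cst 2) (var xn))) ;;
  When (Minus (var xn) (Cst 1)) (optimize ;; Output (var xbest)).

(** * Correctness of the subroutines *)

Lemma divide_ok (s : state) : 0 < s VAR xd -> s VAR xrem <= s VAR xm ->
  eval divide s VAR xq = s VAR xrem %/ s VAR xd.
Proof.
move=> d0 le_m; rewrite /divide !evalE eval_Loop /=.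
set f := eval (When _ _); set s0 := State _ _ _.
have [||td [q -> [tx h]]] := @iter_ind (fun i t => t VAR xd = s VAR xd /\
   exists2 q, t VAR xq = q & t VAR xx + q * s VAR xd = s VAR xrem /\
     (t VAR xx < s VAR xd \/ i <= q)) (s VAR xm) f s0.
- by split=> //; exists 0 => //=; rewrite addn0; split=> //; right.
- move=> i lt_i; move: (iter i f s0) => t [td [q tq [tx hq]]].
  rewrite /f eval_When !evalE /= addn1 subn_gt0 ltnS td.
  case: (leqP (s VAR xd) (t VAR xx)) => [le_d|gt_d]; last first.
    by split=> //; exists q => //; split=> //; left.
  split=> //; exists q.+1; first by rewrite /= tq addn1.
  by rewrite /= ?td; split; [rewrite mulSn; lia|right; case: hq; lia].
have lt_x : iter (s VAR xm) f s0 VAR xx < s VAR xd.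
  by case: h => // le_q; nia.
by rewrite -tx addnC divnMDl // divn_small ?addn0.
Qed.

Lemma check_best (s : state) : s VAR xrem <= s VAR xm ->
  eval check s VAR xbest =
    if s VAR xc <= 1 then s VAR xbest
    else minn (s VAR xbest) (s VAR xrem %/ (s VAR xc - 1)).
Proof.
move=> le_m; rewrite /check evalE eval_When evalE /= subn_gt0 ltnNge.
case: (leqP (s VAR xc) 1) => //= lt1c.
rewrite evalE eval_When /=; set s0 := State _ _ _.
have q0 : eval divide s0 VAR xq = s VAR xrem %/ (s VAR xc - 1).
  by rewrite divide_ok //= subn_gt0.
have -> : eval divide s0 VAR xbest = s VAR xbest by rewrite keeps_varP.
rewrite q0 subn_gt0 minnC; case: (leqP (s VAR xbest)) => [|_]; last by rewrite !evalE /= q0.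
by rewrite keeps_varP.
Qed.

Section Data.
Variables (E : seq (nat * (nat * nat))) (n m : nat).

Let E0 : nat * (nat * nat) := (0, (0, 0)).

Record data (s : state) : Prop := Data {
  data_n : s VAR xn = n;
  data_m : s VAR xm = m;
  data_M : s VAR xM = size E;
  data_EU : forall j, j < size E -> s EU j = (nth E0 E j).2.1;
  data_EV : forall j, j < size E -> s EV j = (nth E0 E j).2.2;
  data_EH : forall j, j < size E -> s EH j = (nth E0 E j).1
}.

Definition keeps_data (c : cmd) : bool :=
  all (keeps_var^~ c) [:: xn; xm; xM] &&
  [&& keeps_array EU c, keeps_array EV c & keeps_array EH c].

Lemma data_eval c s : keeps_data c -> data s -> data (eval c s).
Proof.
case/andP=> /and4P [kn km kM _] /and3P [kU kV kH] [dn dm dM dU dV dH].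
split; rewrite ?keeps_varP // => j lt_j; rewrite keeps_arrayP //; auto.
Qed.

Lemma data_iter c s k : keeps_data c -> data s -> data (iter k (eval c) s).
Proof. by move=> kc ds; elim: k => //= k IH; apply: data_eval. Qed.

Definition is_end (F : seq (nat * (nat * nat))) (x : nat) : bool :=
  has (fun t => (x == t.2.1) || (x == t.2.2)) F.

Lemma is_end_take i x : i < size E -> is_end (take i.+1 E) x =
  [|| x == (nth E0 E i).2.1, x == (nth E0 E i).2.2 | is_end (take i E) x].
Proof. by move=> lt_i; rewrite (take_nth E0) // /is_end has_rcons orbA. Qed.

Lemma clear_labels_ok s x : data s -> is_end E x -> eval clear_labels s LAB x = x.
Proof.
move=> ds; rewrite /clear_labels !evalE eval_Loop /=.
set c := (_ ;; _); set s0 := State _ _ _.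
have ds0 : data s0 by apply: (@data_eval (set_var xj (Cst 0))).
rewrite (data_M ds) -{1}(take_size E).
have [||_ h] := @iter_ind (fun i t => t VAR xj = i /\
    forall x, is_end (take i E) x -> t LAB x = x) (size E) (eval c) s0; last exact: h.
- by rewrite take0.
- move=> i lt_i; have : data (iter i (eval c) s0) by apply: data_iter.
  move: (iter i _ _) => t dt [tj th]; rewrite /c !evalE /=; split=> [|y]; first lia.
  rewrite is_end_take // tj (data_EU dt) // (data_EV dt) //.
  rewrite !eqnE; case: (eqVneq y (nth E0 E i).2.2) => [-> //|_].
  case: (eqVneq y (nth E0 E i).2.1) => [-> //|_]; exact: th.
Qed.

Lemma clear_done_ok s j : data s -> j < m -> eval clear_done s DONE j = 0.
Proof.
move=> ds; rewrite /clear_done !evalE eval_Loop /=.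
set c := (_ ;; _); set s0 := State _ _ _.
rewrite (data_m ds).
have [||_ h] := @iter_ind (fun i t => t VAR xj = i /\
    forall j, j < i -> t DONE j = 0) m (eval c) s0; last exact: h.
- by [].
- move=> i _; move: (iter i _ _) => t [tj th]; rewrite /c !evalE /=.
  split=> [|k]; first lia.
  by rewrite tj eqnE ltnS leq_eqVlt; case: eqP => //= _; apply: th.
Qed.

Lemma select_ok s : data s -> (exists2 j, j < m & s DONE j = 0) ->
  let e := eval select s VAR xe in
  [/\ e < m, s DONE e = 0 &
      forall j, j < m -> s DONE j = 0 -> s LOAD e <= s LOAD j].
Proof.
move=> ds [j1 lt_j1 dj1] /=; rewrite /select !evalE eval_Loop /=.
set c := (_ ;; _); set s0 := State _ _ _.
rewrite (data_m ds).
have [||_ [lt_e h]] := @iter_ind (fun i t => t VAR xj = i /\ (t VAR xe < m /\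
    forall j, j < i -> s DONE j = 0 ->
      s DONE (t VAR xe) = 0 /\ s LOAD (t VAR xe) <= s LOAD j)) m (eval c) s0; last first.
- by have [de le_e] := h _ lt_j1 dj1; split=> // j lt_j /(h _ lt_j) [].
- move=> i lt_i; set t := iter i _ _.
  have tD x : t DONE x = s DONE x by rewrite /t iter_keeps // => *; rewrite keeps_arrayP.
  have tL x : t LOAD x = s LOAD x by rewrite /t iter_keeps // => *; rewrite keeps_arrayP.
  move=> [tj [lt_e th]]; rewrite /c eval_Seq eval_When /= tj tD.
  have [dj|dj] := posnP (s DONE i); last first.
    rewrite (_ : 1 - _ = 0); last by lia.
    rewrite ltnn /=; split; first lia.
    split=> // k; rewrite ltnS leq_eqVlt => /predU1P [-> |]; [lia|exact: th].
  rewrite dj subn0 ltn0Sn eval_When /= tj !tD !tL.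
  case: ifP => hc; rewrite ?evalE /= ?tj addn1; split=> //; split=> // k;
    rewrite ltnS leq_eqVlt => /predU1P [-> _|lt_k dk] //.
  + by have [? ?] := th k lt_k dk; split; lia.
  + by split; lia.
  + exact: th.
- by split=> //; split=> //; apply: leq_ltn_trans lt_j1.
Qed.

Lemma relabel_cell_ok s i x : eval (relabel_cell i) s LAB x =
  if (x == value s i) && (s LAB x == s VAR xa) then s VAR xb else s LAB x.
Proof.
rewrite /relabel_cell eval_When /=.
set d := _ - _; have -> : (0 < d) = (s LAB (value s i) == s VAR xa).
  by rewrite /d; apply/idP/idP; lia.
case: eqP => [e|ne]; rewrite ?evalE /= ?eqnE; case: eqP => //=; move=> ->.
  by rewrite e eqxx.
by case: eqP.
Qed.

(** A vertex may be visited several times, once for each edge at it; this is harmless, as a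
    relabeled cell already holds the label [xb]. *)
Lemma merge_labels_ok s x : data s -> eval merge_labels s LAB x =
  if is_end E x && (s LAB x == s VAR xa) then s VAR xb else s LAB x.
Proof.
move=> ds; rewrite /merge_labels !evalE eval_Loop /=.
set c := (_ ;; _); set s0 := State _ _ _.
have ds0 : data s0 by apply: (@data_eval (set_var xl (Cst 0))).
rewrite (data_M ds) -{2}(take_size E).
have [||_ h] := @iter_ind (fun i t => t VAR xl = i /\
    forall x, t LAB x = if is_end (take i E) x && (s LAB x == s VAR xa)
                        then s VAR xb else s LAB x) (size E) (eval c) s0; last exact: h.
- by rewrite take0.
- move=> i lt_i; set t := iter i _ _; have dt : data t by apply: data_iter.
  have ta : t VAR xa = s VAR xa by rewrite /t iter_keeps // => *; rewrite keeps_varP.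
  have tb : t VAR xb = s VAR xb by rewrite /t iter_keeps // => *; rewrite keeps_varP.
  move=> [tl th]; rewrite /c !evalE /= !(@keeps_varP (relabel_cell _)) //.
  split=> [|y]; first lia.
  rewrite !relabel_cell_ok !(@keeps_varP (relabel_cell _)) // ta tb /=.
  rewrite !(@keeps_varP (relabel_cell _)) // tl !(@keeps_arrayP _ (relabel_cell _)) //.
  rewrite (data_EU dt) // (data_EV dt) // is_end_take // th.
  case: (y == (nth E0 E i).2.1); case: (y == (nth E0 E i).2.2) => //=;
    case: (is_end (take i E) y) => //=; repeat case: eqP => //=; congruence.
Qed.
End Data.

(** * One round *)

Section Round.
Variables (E : seq (nat * (nat * nat))) (n m : nat).
Hypothesis n_gt0 : 0 < n.
Hypothesis E_lt : all (fun t => (t.2.1 < n) && (t.2.2 < n)) E.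

Let E0 : nat * (nat * nat) := (0, (0, 0)).

(** The labeling [f] covers all vertices and exists only in the proof; the memory holds its values
    at endpoints of edges, the only ones that the program reads. *)
Definition labels (f : nat -> nat) (s : state) : Prop :=
  forall x, is_end E x -> s LAB x = f x.

Definition cut_hedge (T : eqType) (g : nat -> T) (i : nat) : bool :=
  has (fun t => (t.1 == i) && (g t.2.1 != g t.2.2)) E.

(** The effect of processing those edges of [F] that belong to hedge [i], with [b] merges. By
    [contracts_pair], the merges of a hedge not cut by [g] also lower the number of pairs (label,
    part of [g]), which bounds the merges inside parts; [contracts_size] later bounds the growth of
    the potential. *)
Record contracts (F : seq (nat * (nat * nat))) (i : nat) (f f' : nat -> nat)
    (b : nat) : Prop := Contracts {
  contracts_eq : forall x y, f x = f y -> f' x = f' y;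
  contracts_edge : forall t, t \in F -> t.1 = i -> f' t.2.1 = f' t.2.2;
  contracts_classes : classes n f' + b = classes n f;
  contracts_pair : forall (T : eqType) (g : nat -> T),
    classes n (fun x => (f' x, g x)) + ~~ cut_hedge g i * b
      <= classes n (fun x => (f x, g x));
  contracts_size : b <= size F
}.

Lemma process_edge_ok (s : state) f j :
  data E n m s -> labels f s -> s VAR xc = classes n f ->
  j < size E -> s VAR xj = j -> (nth E0 E j).1 = s VAR xe ->
  let s' := eval process_edge s in
  exists f' (b : bool), [/\ labels f' s', s' VAR xc = classes n f',
    forall x, s' LOAD x = s LOAD x + (x == s VAR xe) * b
    & contracts [:: nth E0 E j] (s VAR xe) f f' b].
Proof.
move=> ds lf sc lt_j sj he /=.
set t := nth E0 E j in he *; have tE : t \in E by apply: mem_nth.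
have /andP [lt_u lt_v] := allP E_lt _ tE.
have eu : is_end E t.2.1 by apply/hasP; exists t; rewrite ?eqxx.
have ev : is_end E t.2.2 by apply/hasP; exists t; rewrite ?eqxx ?orbT.
have lu : s LAB (s EU j) = f t.2.1 by rewrite (data_EU ds) // lf.
have lv : s LAB (s EV j) = f t.2.2 by rewrite (data_EV ds) // lf.
rewrite /process_edge !evalE /= eval_When dist_eq0 /= sj lu lv.
set s1 := State _ _ _.
have ds1 : data E n m s1 by case: ds.
case: eqP => /= [eq_uv|/eqP ne_uv].
  exists f, false; split=> // [x|]; first by rewrite muln0 addn0.
  split=> //; first by move=> _ /[1!inE] /eqP ->.
  - by rewrite addn0.
  - by move=> T g; rewrite muln0 addn0.
rewrite eval_Seq; set s2 := eval merge_labels _.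
have s2c : s2 VAR xc = s VAR xc by rewrite keeps_varP.
have s2e : s2 VAR xe = s VAR xe by rewrite keeps_varP.
have s2L x : s2 LOAD x = s LOAD x by rewrite keeps_arrayP.
have s2l x : s2 LAB x = _ := merge_labels_ok x ds1.
rewrite !evalE /=.
exists (relabel f (f t.2.1) (f t.2.2)), true.
have cl := classes_relabel lt_u lt_v ne_uv.
split.
- by move=> x ex; rewrite /= s2l ex /= lf.
- by rewrite /= s2c sc -cl subn1.
- move=> x; rewrite /= s2e s2L eqnE.
  by case: eqP => [->|_]; rewrite /= ?mul1n ?addn0.
split.
- by move=> x y; rewrite /relabel => ->.
- by move=> _ /[1!inE] /eqP -> _; rewrite /relabel eqxx if_same.
- by rewrite addn1.
- move=> T g; apply: leq_trans (classes_pair_relabel g lt_u lt_v ne_uv).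
  (* An edge between two parts of [g] witnesses that its hedge is cut, so that its merge has
     coefficient 0. *)
  rewrite leq_add2l muln1; case: eqP => [_|/eqP ne]; first by case: cut_hedge.
  rewrite (_ : cut_hedge g _ = true) //; apply/hasP; exists t => //.
  by rewrite he eqxx ne.
- by [].
Qed.

Lemma contracts_rcons F t i f f1 f2 b1 b2 :
  contracts F i f f1 b1 -> contracts [:: t] i f1 f2 b2 ->
  contracts (rcons F t) i f f2 (b1 + b2).
Proof.
move=> [q1 e1 c1 p1 s1] [q2 e2 c2 p2 s2]; split.
- by move=> x y /q1 /q2.
- move=> x; rewrite mem_rcons inE => /predU1P [->|xF] xi.
    by apply: e2 => //; rewrite inE.
  exact/q2/e1.
- by rewrite [b1 + _]addnC addnA c2 c1.
- by move=> T g; have := p1 T g; have := p2 T g; rewrite mulnDr; lia.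
- by rewrite size_rcons -addn1 leq_add.
Qed.

Lemma contracts_skip t i f : t.1 != i -> contracts [:: t] i f f 0.
Proof.
move=> /eqP ne; split=> //; rewrite ?addn0 //.
  by move=> _ /[1!inE] /eqP ->.
by move=> T g; rewrite muln0 addn0.
Qed.

Lemma process_ok (s : state) f :
  data E n m s -> labels f s -> s VAR xc = classes n f ->
  let s' := eval process s in
  exists f' b, [/\ labels f' s', s' VAR xc = classes n f',
    forall x, s' LOAD x = s LOAD x + (x == s VAR xe) * b
    & contracts E (s VAR xe) f f' b].
Proof.
move=> ds lf sc /=; rewrite /process evalE eval_Loop.
set c := (_ ;; _); set s0 := eval _ s.
have ds0 : data E n m s0 by apply: data_eval ds.
have -> : value s0 (var xM) = size E by rewrite /= (data_M ds).
pose I i (t : state) := t VAR xj = i /\ exists f' b,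
    [/\ labels f' t, t VAR xc = classes n f',
    forall x, t LOAD x = s LOAD x + (x == s VAR xe) * b
    & contracts (take i E) (s VAR xe) f f' b].
have [||_] := @iter_ind I (size E) (eval c) s0; last by rewrite take_size.
- split=> //; exists f, 0; split=> // [x|]; first by rewrite muln0 addn0.
  rewrite take0; split=> //; first by rewrite addn0.
  by move=> T g; rewrite muln0 addn0.
- move=> i lt_i; set t := iter i _ _; have dt : data E n m t by apply: data_iter.
  have te : t VAR xe = s VAR xe by rewrite /t iter_keeps // => *; rewrite keeps_varP.
  move=> [tj [f1 [b1 [l1 c1 L1 C1]]]]; rewrite /c evalE eval_When.
  have -> : (0 < value t (Minus (Cst 1) (dist (Cell EH (var xj)) (var xe)))) =
     ((nth E0 E i).1 == s VAR xe).
    rewrite /= tj te (data_EH dt) // -/E0; move: (nth _ _ _).1 (s _ _) => x y.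
    by apply/idP/eqP; lia.
  rewrite evalE /I (take_nth E0) //; case: eqP => [he|/eqP ne]; last first.
    split=> [|/=]; first by rewrite /= tj addn1.
    exists f1, b1; split=> //; rewrite -[b1]addn0; apply: contracts_rcons C1 _.
    exact: contracts_skip.
  have [|f2 [b2 [l2 c2 L2 C2]]] := process_edge_ok dt l1 c1 lt_i tj.
    by rewrite te.
  split=> [|/=]; first by rewrite /= keeps_varP // tj addn1.
  exists f2, (b1 + b2); split=> //.
    by move=> x; rewrite L2 L1 te mulnDr addnA.
  by apply: contracts_rcons C1 _; rewrite -te.
Qed.

Definition ncut (T : eqType) (g : nat -> T) : nat := count (cut_hedge g) (iota 0 m).

(** A certificate that the connectivity is at most [k]. *)
Definition attained (k : nat) : Prop := exists f : nat -> nat,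
  1 < classes n f /\ ncut f %/ (classes n f - 1) <= k.

(* [o] lists the hedges processed so far, [f] labels the components of these
   hedges, [B j] is the number of components merged by hedge [j], and [L] is
   the load at the beginning of the round. *)
Record in_round (L : nat -> nat) (k : nat) (s : state) (o : seq nat)
    (f B : nat -> nat) : Prop := InRound {
  round_data : data E n m s;
  round_uniq : uniq o;
  round_lt : {in o, forall j, j < m};
  round_done : forall j, j < m -> s DONE j = (j \in o);
  round_load : forall j, s LOAD j = L j + B j;
  round_unprocessed : forall j, j \notin o -> B j = 0;
  round_size : forall j, B j <= size E;
  round_labels : labels f s;
  round_classes : s VAR xc = classes n f;
  round_rem : s VAR xrem = m - size o;
  round_edge : forall t, t \in E -> t.1 \in o -> f t.2.1 = f t.2.2;
  round_total : classes n f + \sum_(j <- o) B j = n;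
  round_pair : forall (T : eqType) (g : nat -> T),
    classes n (fun x => (f x, g x)) + \sum_(j <- o) ~~ cut_hedge g j * B j <= n;
  round_sorted : sorted (relpre L leq) o;
  round_min : {in o, forall x, forall j, j < m -> j \notin o -> L x <= L j};
  round_attained : attained (s VAR xbest);
  round_best : s VAR xbest <= k
}.

(* [classes n f + \sum_(j <- o2) B j] is the number of components after the
   processing of [o1]. *)
Definition prefixes_checked (best : nat) (o : seq nat) (f B : nat -> nat) : Prop :=
  forall o1 o2, o = o1 ++ o2 ->
    best * (classes n f + \sum_(j <- o2) B j - 1) <= m - size o1.

(** A processed hedge has both ends of each of its edges in one component, so that only unprocessed
    hedges can be cut by [f]. *)
Lemma ncut_processed L k s o f B : in_round L k s o f B -> ncut f <= m - size o.
Proof.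
move=> I; rewrite /ncut -size_filter.
rewrite -[m in m - _](size_iota 0) leq_subRL; last first.
  apply: uniq_leq_size (round_uniq I) _ => j /(round_lt I); by rewrite mem_iota.
rewrite -size_cat; apply: uniq_leq_size.
  rewrite cat_uniq (round_uniq I) filter_uniq ?iota_uniq // andbT.
  apply/hasPn => j; rewrite mem_filter => /andP [/hasP [t tE /andP [/eqP tj ne]] _].
  by apply: contra ne => jo; rewrite (round_edge I) ?tj.
move=> j; rewrite mem_cat mem_filter => /orP [/(round_lt I)|/andP[//]].
by rewrite mem_iota.
Qed.

(** The hypothesis deals with the proper prefixes of [o], checked earlier, and survives a decrease
    of [xbest]; the present check adds the prefix [o] itself. *)
Lemma check_ok L k s o f B : in_round L k s o f B ->
  (forall o1 x o2, o = o1 ++ x :: o2 -> s VAR xbest *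
     (classes n f + \sum_(j <- x :: o2) B j - 1) <= m - size o1) ->
  let s' := eval check s in
  in_round L k s' o f B /\ prefixes_checked (s' VAR xbest) o f B.
Proof.
move=> I suf /=; have le_cut := ncut_processed I.
have := @check_best s; rewrite (round_rem I) (round_classes I).
rewrite (data_m (round_data I)) => /(_ (leq_subr _ _)) eb.
have [le_b at_b] : eval check s VAR xbest <= s VAR xbest /\
    attained (eval check s VAR xbest).
  rewrite eb; case: (leqP (classes n f) 1) => [|lt1].
    by split=> //; apply: (round_attained I).
  split; first exact: geq_minl.
  rewrite /minn; case: ifP => _; first exact: (round_attained I).
  by exists f; split=> //; apply: leq_div2r.
split.
  case: (I) => *; split; rewrite ?(@keeps_varP _ _ xc) ?(@keeps_varP _ _ xrem) //.
  - exact: data_eval.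
  - by move=> *; rewrite keeps_arrayP //; auto.
  - by move=> *; rewrite keeps_arrayP //; auto.
  - by move=> *; rewrite keeps_arrayP //; auto.
  - exact: leq_trans (round_best I).
move=> o1 [|x o2] e; last first.
  by apply: leq_trans (suf _ _ _ e); rewrite leq_mul2r le_b orbT.
rewrite cats0 in e; rewrite -e big_nil addn0 eb.
case: (leqP (classes n f) 1) => [|lt1]; first by rewrite -subn_eq0 => /eqP ->; rewrite muln0.
apply: (@leq_trans ((m - size o) %/ (classes n f - 1) * (classes n f - 1))).
  by rewrite leq_mul2r geq_minr orbT.
exact: leq_divM.
Qed.

Lemma process_next_ok L k s o f B :
  in_round L k s o f B -> prefixes_checked (s VAR xbest) o f B -> size o < m ->
  exists e f' B', let s' := eval process_next s in
    in_round L k s' (rcons o e) f' B' /\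
    prefixes_checked (s' VAR xbest) (rcons o e) f' B'.
Proof.
move=> I suf lt_o.
have undone : exists2 j, j < m & s DONE j = 0.
  have [j] : exists2 j, j \in iota 0 m & j \notin o.
    apply/hasP; apply: contraLR lt_o => /hasPn sub; rewrite -leqNgt.
    rewrite -[m](size_iota 0); apply: uniq_leq_size (iota_uniq _ _) _ => j /sub.
    by rewrite negbK.
  rewrite mem_iota => lt_j no; exists j => //.
  by rewrite (round_done I) ?(negbTE no).
rewrite /process_next !(eval_Seq select) eval_Seq.
set s1 := eval select s.
have [] := select_ok (round_data I) undone.
rewrite -/s1; set e := s1 VAR xe => lt_e de min_e.
have eo : e \notin o by move: de; rewrite (round_done I) //; case: (e \in o).
have Be := round_unprocessed I eo.
have l1 : labels f s1 by move=> x /(round_labels I) <-; rewrite keeps_arrayP.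
have ds1 : data E n m s1 by apply: data_eval (round_data I).
have c1 : s1 VAR xc = classes n f by rewrite keeps_varP // (round_classes I).
have [f' [b [l2 c2 L2 C]]] := process_ok ds1 l1 c1.
rewrite -/e in L2 C; set s2 := eval process s1 in l2 c2 L2 *.
have ds2 : data E n m s2 by apply: data_eval ds1.
have e2 : s2 VAR xe = e by rewrite keeps_varP.
have d2 j : s2 DONE j = s DONE j by rewrite !keeps_arrayP.
have b2 : s2 VAR xbest = s VAR xbest by rewrite !keeps_varP.
have r2 : s2 VAR xrem = s VAR xrem by rewrite !keeps_varP.
have L1 j : s1 LOAD j = L j + B j by rewrite keeps_arrayP // (round_load I).
rewrite !eval_Seq; set s3 := eval (set_var xrem _) (eval (Assign DONE _ _) s2).
pose B' j := B j + (j == e) * b.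
have sumB' (h : nat -> nat) : \sum_(j <- o) h j * B' j = \sum_(j <- o) h j * B j.
  apply: eq_big_seq => j jo; rewrite /B'; case: eqP => [ej|_]; rewrite ?addn0 //.
  by rewrite -ej jo in eo.
have B'e : B' e = b by rewrite /B' Be eqxx mul1n.
have I3 : in_round L k s3 (rcons o e) f' B'.
  split.
  - by case: ds2.
  - by rewrite rcons_uniq eo (round_uniq I).
  - by move=> j; rewrite mem_rcons inE => /predU1P [-> //|/(round_lt I)].
  - move=> j lt_j; rewrite /s3 !evalE /= e2 eqnE mem_rcons inE d2.
    by case: eqP => //= _; apply: (round_done I).
  - by move=> j; rewrite /s3 !evalE /= L2 L1 addnA.
  - move=> j; rewrite mem_rcons inE negb_or /B' => /andP [/negbTE -> /(round_unprocessed I) ->].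
    by [].
  - move=> j; rewrite /B'; case: eqP => [->|_]; last by rewrite addn0 (round_size I).
    by rewrite Be mul1n (contracts_size C).
  - exact: l2.
  - exact: c2.
  - by rewrite /s3 !evalE /= r2 (round_rem I) size_rcons; lia.
  - move=> t tE; rewrite mem_rcons inE => /predU1P [te|to].
      exact: (contracts_edge C) tE te.
    by apply: (contracts_eq C); apply: (round_edge I) tE to.
  - rewrite big_rcons /= B'e addnCA (contracts_classes C).
    have := sumB' (fun=> 1); under eq_bigr do rewrite mul1n.
    under [X in _ = X]eq_bigr do rewrite mul1n.
    by move=> ->; rewrite addnC (round_total I).
  - move=> T g; have := round_pair I g; have := contracts_pair C g.
    by rewrite big_rcons /= B'e sumB'; lia.
  - case: (o) (round_sorted I) (round_min I) eo => //= x o' so mino eo.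
    rewrite rcons_path so /=; apply: mino; rewrite ?mem_last //.
  - move=> x; rewrite mem_rcons inE => /predU1P [->|xo] j lt_j.
      (* [select] compares current loads, but those of unprocessed hedges have not changed since the
         beginning of the round. *)
      rewrite mem_rcons inE negb_or => /andP [_ jo].
      have := min_e _ lt_j; rewrite (round_done I) // (negbTE jo) => /(_ erefl).
      by rewrite !(round_load I) Be (round_unprocessed I jo) !addn0.
    rewrite mem_rcons inE negb_or => /andP [_ jo]; exact: (round_min I) xo _ lt_j jo.
  - by rewrite /s3 !evalE /= b2; apply: (round_attained I).
  - by rewrite /s3 !evalE /= b2; apply: (round_best I).
exists e, f', B'; apply: (check_ok I3) => o1 x o2.
have -> : s3 VAR xbest = s VAR xbest by rewrite /s3 !evalE /= b2.
(* A nonempty suffix of [rcons o e] ends with [e]. Since [classes n f' + b = classes n f], removing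
   [e] leaves the inequality already known for [o]. *)
move: (x :: o2) (isT : x :: o2 != [::]) => {}o2.
case/lastP: o2 => [//|o3 y] _.
rewrite -rcons_cat => /rcons_inj [eo3 <-]; rewrite big_rcons /= addnA.
have -> : \sum_(j <- o3) B' j = \sum_(j <- o3) B j.
  apply: eq_big_seq => j jo; rewrite /B'; case: eqP => [ej|_]; rewrite ?addn0 //.
  by move: eo; rewrite eo3 mem_cat -ej jo orbT.
rewrite B'e addnAC (contracts_classes C); exact: suf.
Qed.

(** The witness for [p] is the number of components left by all the hedges, so that
    [p + \sum_(j <- o2) B j] counts those of the prefix [o1]. The labeling [g] comes after [o] and
    [B], as the algorithm does not know the partition it is compared with. *)
Lemma round_ok (s : state) : data E n m s -> attained (s VAR xbest) ->
  exists o B, let s' := eval round s in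
    [/\ perm_eq o (iota 0 m), sorted (relpre (s LOAD) leq) o,
        forall j, s' LOAD j = s LOAD j + B j, forall j, B j <= size E
      & [/\ attained (s' VAR xbest), s' VAR xbest <= s VAR xbest,
          exists2 p, 0 < p & p + \sum_(j <- o) B j = n /\
            forall o1 o2, o = o1 ++ o2 ->
              s' VAR xbest * (p + \sum_(j <- o2) B j - 1) <= size o2
        & forall (T : eqType) (g : nat -> T),
            classes n g + \sum_(j <- o) ~~ cut_hedge g j * B j <= n]].
Proof.
move=> ds at_s; rewrite /round 5!eval_Seq eval_Loop.
set s1 := eval (set_var xrem _) _; set s2 := eval clear_labels s1.
set s3 := eval clear_done s2.
have ds1 : data E n m s1 by do 2 apply: data_eval => //.
have ds2 : data E n m s2 by apply: data_eval.
have ds3 : data E n m s3 by apply: data_eval.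
have b3 : s3 VAR xbest = s VAR xbest by rewrite !keeps_varP.
have I0 : in_round (s LOAD) (s VAR xbest) s3 [::] id (fun=> 0).
  split=> //; rewrite ?big_nil ?addn0 ?b3 //.
  - by move=> j lt_j; rewrite (clear_done_ok ds2).
  - by move=> j; rewrite !keeps_arrayP // addn0.
  - by move=> x ex; rewrite keeps_arrayP // (clear_labels_ok ds1).
  - by rewrite 3?keeps_varP //= (data_n ds) classes_inj.
  - by rewrite 2?keeps_varP //= (data_m ds) subn0.
  - exact: classes_inj.
  - by move=> T g; rewrite big_nil addn0 classes_le.
have {I0} [] := check_ok I0; first by case.
set s4 := eval check s3 => I4 suf4; rewrite -/s4.
have -> : value s4 (var xm) = m by exact: data_m (round_data I4).
pose J i (t : state) := exists o f B, [/\ size o = i,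
  in_round (s LOAD) (s VAR xbest) t o f B & prefixes_checked (t VAR xbest) o f B].
have [||o [f [B [sz_o I suf]]]] := @iter_ind J m (eval process_next) s4.
- by exists [::], id, (fun=> 0).
- move=> i lt_i [o [f [B [sz_o I suf]]]].
  have [|e [f' [B' [I' suf']]]] := process_next_ok I suf.
    by rewrite sz_o.
  by exists (rcons o e), f', B'; rewrite size_rcons sz_o.
have perm_o : perm_eq o (iota 0 m).
  have sub : {subset o <= iota 0 m} by move=> j /(round_lt I); rewrite mem_iota.
  apply: uniq_perm (round_uniq I) (iota_uniq _ _) _.
  have [|_ //] := uniq_min_size (round_uniq I) sub.
  by rewrite size_iota sz_o.
exists o, B => /=; split=> //.
- exact: (round_sorted I).
- exact: (round_load I).
- exact: (round_size I).
split; [exact: (round_attained I)|exact: (round_best I)| |move=> T g].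
  exists (classes n f); first exact: classes_gt0.
  split; first exact: (round_total I).
  move=> o1 o2 eo; have -> : size o2 = m - size o1 by rewrite -sz_o eo size_cat addKn.
  exact: suf.
apply: leq_trans (round_pair I g); rewrite leq_add2r; exact: classes_le_pair.
Qed.
End Round.

(** * Optimality *)

Lemma nested_ok k c (s : state) : keeps_var xZ c ->
  eval (nested k c) s = iter (s VAR xZ ^ k) (eval c) s.
Proof.
move=> kc; elim: k s => [|k IH] s //; rewrite /= eval_Loop expnS iterM /=.
have H i : iter i (eval (nested k c)) s = iter i (iter (s VAR xZ ^ k) (eval c)) s.
  elim: i => //= i ->; rewrite IH -iterM iter_keeps // => t; exact: keeps_varP.
exact: H.
Qed.

Section Optimize.
Variables (E : seq (nat * (nat * nat))) (n m : nat).
Hypothesis n_gt1 : 1 < n.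
Hypothesis E_lt : all (fun t => (t.2.1 < n) && (t.2.2 < n)) E.

Let Z := m + size E + 2.

(** The final value of [xbest] is unknown during the rounds. The bounds are therefore kept for every
    [k] up to the current value that some [g] violates; as [xbest] only decreases, they remain
    available for the final one. *)
Record progress (t : nat) (s : state) : Prop := Progress {
  progress_data : data E n m s;
  progress_attained : attained E n m (s VAR xbest);
  progress_best : s VAR xbest <= m;
  progress_potential : forall k (T : eqType) (g : nat -> T), k <= s VAR xbest ->
    ncut E m g < k * (classes n g - 1) ->
    \sum_(j <- iota 0 m) (k * s LOAD j - t) ^ 2 <= t * (m * Z ^ 4);
  progress_cut : forall k (T : eqType) (g : nat -> T), k <= s VAR xbest ->
    ncut E m g < k * (classes n g - 1) ->
    t * (ncut E m g).+1 <= \sum_(j <- iota 0 m | cut_hedge E g j) k * s LOAD j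
}.

Lemma round_progress t s : progress t s -> progress t.+1 (eval round s).
Proof.
move=> P; have n_gt0 := ltnW n_gt1.
have [o [B [perm_o sort_o L' leB [at_b le_b [p p0 [tot suf]] pair]]]] :=
  round_ok n_gt0 E_lt (progress_data P) (progress_attained P).
set s' := eval round s in L' at_b le_b suf *.
(* The empty suffix gives [xbest] times p - 1 at most 0: a positive value of [xbest] means that the
   hedges connect all the vertices. *)
have one k : 0 < k -> k <= s' VAR xbest -> p = 1.
  move=> k0 le_k; have := suf o [::]; rewrite cats0 big_nil addn0 => /(_ erefl).
  by rewrite leqn0 muln_eq0 subn_eq0; lia.
split.
- exact: data_eval (progress_data P).
- exact: at_b.
- exact: leq_trans le_b (progress_best P).
- move=> k T g le_k lt_cut.
  have := progress_potential P (leq_trans le_k le_b) lt_cut.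
  have k0 : 0 < k by case: (k) lt_cut.
  move=> h; under eq_bigr do rewrite L'; rewrite mulSnr.
  apply: (@leq_trans (\sum_(j <- iota 0 m) (k * s LOAD j - t) ^ 2 + m * Z ^ 4));
    last by rewrite leq_add2r.
  apply: potential_step perm_o sort_o _ _.
  + move=> o1 o2 eo; apply: leq_trans (suf _ _ eo).
    by rewrite (one k) // add1n subn1 /= leq_mul2r le_k orbT.
  (* From k <= m and B_j <= [size E] follows k B_j < Z^2, whence the bound Z^4 on the square plus
     1. *)
  + move=> j; have : k * B j <= m * size E.
      apply: leq_mul => //; apply: leq_trans le_k _.
      exact: leq_trans le_b (progress_best P).
    move: (k * B j) => x; rewrite (expnM Z 2 2) -!mulnn addn1 => le_x.
    by rewrite ltn_mul //; rewrite /Z; nia.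
- move=> k T g le_k lt_cut.
  have := progress_cut P (leq_trans le_k le_b) lt_cut.
  have k0 : 0 < k by case: (k) lt_cut.
  move=> h; under eq_bigr do rewrite L' mulnDr; rewrite big_split /= mulSnr.
  rewrite leq_add // -big_distrr /=; apply: leq_trans lt_cut _.
  rewrite leq_mul2l; apply/orP; right; have := pair _ g; have := tot.
  rewrite (one k) // !(perm_big _ perm_o) /= (bigID (cut_hedge E g)) /=.
  have -> : \sum_(j <- iota 0 m) ~~ cut_hedge E g j * B j =
      \sum_(j <- iota 0 m | ~~ cut_hedge E g j) B j.
    by rewrite [RHS]big_mkcond; apply: eq_bigr => j _; case: cut_hedge; rewrite ?mul1n.
  by move: (\sum_(j <- _ | _) _) (\sum_(j <- _ | ~~ _) _) => x y; lia.
Qed.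

Lemma optimize_ok (s : state) : data E n m s -> (forall j, s LOAD j = 0) ->
  let b := eval optimize s VAR xbest in
  attained E n m b /\
  forall (T : eqType) (g : nat -> T), b * (classes n g - 1) <= ncut E m g.
Proof.
move=> ds L0; rewrite /optimize 2!eval_Seq.
set s1 := eval (set_var xZ _) _.
have ds1 : data E n m s1 by do 2 apply: data_eval => //.
have s1b : s1 VAR xbest = m by rewrite keeps_varP //= (data_m ds).
have s1L j : s1 LOAD j = 0 by rewrite !keeps_arrayP.
have s1Z : s1 VAR xZ = Z by rewrite /= (data_m ds) (data_M ds).
have P0 : progress 0 s1.
  split=> //; rewrite ?s1b //.
  (* The initial value m need not be a ratio; it is certified by the partition into singletons,
     which has at least two parts as n > 1. *)
  - exists id; rewrite classes_inj //; split=> //; apply: leq_trans (leq_div _ _) _.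
    by rewrite -[leqRHS](size_iota 0) count_size.
  - move=> *; under eq_bigr do rewrite s1L muln0 sub0n.
    by rewrite big1.
rewrite nested_ok // s1Z.
have P : progress (Z ^ 6) (iter (Z ^ 6) (eval round) s1).
  by elim: (Z ^ 6) => //= t; apply: round_progress.
split; first exact: (progress_attained P).
move=> T g; rewrite leqNgt; apply/negP => lt_cut.
(* Both bounds are used with [k] the final value of [xbest]. *)
apply: (potential_contradiction _ (progress_potential P (leqnn _) lt_cut)
  (progress_cut P (leqnn _) lt_cut)).
by rewrite /Z -addnA -[ltnLHS]addn0 ltn_add2l addn2.
Qed.
End Optimize.

(** * Reading the input *)

Definition code_hyperedge (r : seq nat) : seq nat := size r :: r.
Definition code_hedge (q : seq (seq nat)) : seq nat :=
  size q :: flatten [seq code_hyperedge r | r <- q].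
Definition code_hedges (Q : seq (seq (seq nat))) : seq nat :=
  size Q :: flatten [seq code_hedge q | q <- Q].

(* A hyperedge is replaced by a star on its vertices, which has the same
   components and is cut by the same partitions. *)
Definition star (r : seq nat) : seq (nat * nat) :=
  if r is x :: r' then [seq (x, y) | y <- r'] else [::].
Definition hedge_edges (q : seq (seq nat)) : seq (nat * nat) :=
  flatten [seq star r | r <- q].
Definition numbered (i : nat) (es : seq (nat * nat)) : seq (nat * (nat * nat)) :=
  [seq (i, uv) | uv <- es].
Fixpoint edges_from (i : nat) (H : seq (seq (nat * nat))) : seq (nat * (nat * nat)) :=
  if H is es :: H' then numbered i es ++ edges_from i.+1 H' else [::].

Section Parse.
Variables (N n m : nat).
Hypothesis N_gt0 : 0 < N.

(** The counts of the parsing loops are read from the input, beyond the reach of a syntactic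
    criterion. The invariant, indexed by the items still to be read, yields the bounds together with
    the result. *)
Lemma iter_list (T : Type) (c : cmd) (I : seq T -> state -> Prop) :
  (forall x l s, I (x :: l) s -> loops_bounded N c s /\ I l (eval c s)) ->
  forall l s, I l s ->
    (forall i, i < size l -> loops_bounded N c (iter i (eval c) s)) /\
    I [::] (iter (size l) (eval c) s).
Proof.
move=> step; elim=> [|x l IH] s Is; first by [].
have [b /IH [bs I0]] := step _ _ _ Is; rewrite iterSr; split=> // -[|i] lt_i //.
by rewrite iterSr; apply: bs.
Qed.

Lemma bounded_When e c (s : state) : (0 < value s e -> loops_bounded N c s) ->
  loops_bounded N (When e c) s.
Proof.
move=> bc; split; first by apply: leq_trans N_gt0; exact: leq_subr.
by move=> [|i] /=; [move=> h; apply: bc; lia|lia].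
Qed.

Lemma parse_edge_ok E s x y w i :
  data E n m s -> inp s = y :: w -> s VAR xu = x -> s VAR xh = i ->
  let s' := eval parse_edge s in
  [/\ data (rcons E (i, (x, y))) n m s', inp s' = w, s' VAR xu = x & s' VAR xh = i].
Proof.
move=> [dn dm dM dU dV dH] inps su sh /=; rewrite /parse_edge.
split=> //=; rewrite ?inps //; split=> //=; rewrite ?inps ?size_rcons ?dM ?addn1 //.
- move=> j; rewrite ltnS leq_eqVlt nth_rcons eqnE => /predU1P [->|lt_j].
    by rewrite ltnn eqxx.
  by rewrite lt_j (ltn_eqF lt_j) dU.
- move=> j; rewrite ltnS leq_eqVlt nth_rcons eqnE => /predU1P [->|lt_j].
    by rewrite ltnn eqxx.
  by rewrite lt_j (ltn_eqF lt_j) dV.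
- move=> j; rewrite ltnS leq_eqVlt nth_rcons eqnE => /predU1P [->|lt_j].
    by rewrite ltnn eqxx.
  by rewrite lt_j (ltn_eqF lt_j) dH.
Qed.

Lemma parse_hyperedge_ok E s r w i :
  data E n m s -> inp s = code_hyperedge r ++ w -> s VAR xh = i -> size r <= N ->
  let s' := eval parse_hyperedge s in
  [/\ loops_bounded N parse_hyperedge s, data (E ++ numbered i (star r)) n m s',
      inp s' = w & s' VAR xh = i].
Proof.
move=> ds inps sh le_r /=; rewrite /parse_hyperedge eval_Seq.
set s1 := eval (Input xr) s.
have ds1 : data E n m s1 by apply: data_eval ds.
have inps1 : inp s1 = r ++ w by rewrite /= inps.
have r1 : s1 VAR xr = size r by rewrite /= inps.
rewrite eval_When (_ : value s1 (var xr) = size r) //.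
suff [b D] : (0 < size r ->
    loops_bounded N (Input xu ;; Loop (Minus (var xr) (Cst 1)) parse_edge) s1) /\
    let s' := if 0 < size r
      then eval (Input xu ;; Loop (Minus (var xr) (Cst 1)) parse_edge) s1 else s1 in
    [/\ data (E ++ numbered i (star r)) n m s', inp s' = w & s' VAR xh = i].
  have bw : loops_bounded N (When (var xr)
      (Input xu ;; Loop (Minus (var xr) (Cst 1)) parse_edge)) s1.
    by apply: bounded_When => h; apply: b; rewrite -r1.
  by case: D => d i' h'; split=> //; exact: (conj Logic.I bw).
case: r inps inps1 r1 le_r => [|x t] inps inps1 r1 le_r /=.
  by split=> //; split; rewrite ?cats0.
set s2 := eval (Input xu) s1.
have ds2 : data E n m s2 by apply: data_eval ds1.
have inps2 : inp s2 = t ++ w by rewrite /s2 /= inps.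
have u2 : s2 VAR xu = x by rewrite /s2 /= inps.
have h2 : s2 VAR xh = i by rewrite /s2 /= sh.
pose goal := E ++ numbered i [seq (x, y) | y <- t].
pose I l (s : state) := exists F, [/\ data F n m s,
  F ++ numbered i [seq (x, y) | y <- l] = goal, inp s = l ++ w, s VAR xu = x
  & s VAR xh = i].
have [||b2 [F [dF eF inpF _ hF]]] := @iter_list _ parse_edge I _ t s2.
- move=> y l u [F [dF eF inpF uF hF]]; split=> //.
  have [d' i' u' h'] := parse_edge_ok dF inpF uF hF.
  by exists (rcons F (i, (x, y))); rewrite cat_rcons.
- by exists E.
rewrite cats0 in eF.
have v2 : value s2 (Minus (var xr) (Cst 1)) = size t by rewrite /= inps /= subn1.
have bl : loops_bounded N (Loop (Minus (var xr) (Cst 1)) parse_edge) s2.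
  by split; rewrite v2 // ltnW.
rewrite eval_Seq eval_Loop -/s2 v2; split; last by rewrite -/goal -eF.
by move=> _; exact: (conj Logic.I bl).
Qed.

Lemma parse_hedge_ok E s q w i :
  data E n m s -> inp s = code_hedge q ++ w -> s VAR xh = i ->
  size q <= N -> all (fun r => size r <= N) q ->
  let s' := eval parse_hedge s in
  [/\ loops_bounded N parse_hedge s, data (E ++ numbered i (hedge_edges q)) n m s',
      inp s' = w & s' VAR xh = i.+1].
Proof.
move=> ds inps sh le_q all_q /=; rewrite /parse_hedge 2!eval_Seq eval_Loop.
set s1 := eval (Input xq) s.
have ds1 : data E n m s1 by apply: data_eval ds.
have inps1 : inp s1 = flatten [seq code_hyperedge r | r <- q] ++ w by rewrite /= inps.
have v1 : value s1 (var xq) = size q by rewrite /= inps.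
have h1 : s1 VAR xh = i by rewrite keeps_varP.
pose goal := E ++ numbered i (hedge_edges q).
pose I l (s : state) := all (fun r => size r <= N) l /\ exists F, [/\ data F n m s,
  F ++ numbered i (hedge_edges l) = goal,
  inp s = flatten [seq code_hyperedge r | r <- l] ++ w & s VAR xh = i].
have [||b [_ [F [dF eF inpF hF]]]] := @iter_list _ parse_hyperedge I _ q s1.
- move=> r l u [/andP [le_r all_l] [F [dF eF inpF hF]]].
  have {}inpF : inp u = code_hyperedge r ++ flatten [seq code_hyperedge r | r <- l] ++ w.
    by rewrite inpF /= -catA.
  have [b' d' i' h'] := parse_hyperedge_ok dF inpF hF le_r.
  split=> //; split=> //; exists (F ++ numbered i (star r)); split=> //.
  by rewrite -eF /hedge_edges /= /numbered map_cat catA.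
- by split=> //; exists E.
rewrite cats0 in eF; rewrite v1 evalE; split=> //.
- have bl : loops_bounded N (Loop (var xq) parse_hyperedge) s1 by split; rewrite v1.
  exact: (conj Logic.I (conj bl Logic.I)).
- by rewrite -/goal -eF; apply: (@data_eval _ _ _ (incr xh)) dF.
- by rewrite /= hF addn1.
Qed.

End Parse.

Lemma parse_ok N n (Q : seq (seq (seq nat))) :
  0 < N -> size Q <= N ->
  all (fun q => (size q <= N) && all (fun r => size r <= N) q) Q ->
  let s := start (n :: code_hedges Q) in let s' := eval parse s in
  [/\ loops_bounded N parse s,
      data (edges_from 0 [seq hedge_edges q | q <- Q]) n (size Q) s'
    & forall j, s' LOAD j = 0].
Proof.
move=> N0 le_Q all_Q s.
suff [b d] : loops_bounded N parse s /\
   data (edges_from 0 [seq hedge_edges q | q <- Q]) n (size Q) (eval parse s).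
  by split=> // j; rewrite keeps_arrayP.
rewrite /parse 2!eval_Seq eval_Loop.
set s1 := eval (Input xm) (eval (Input xn) s).
have ds1 : data [::] n (size Q) s1 by [].
have inps1 : inp s1 = flatten [seq code_hedge q | q <- Q] by [].
have v1 : value s1 (var xm) = size Q by [].
pose goal := edges_from 0 [seq hedge_edges q | q <- Q].
pose ok : seq (seq (seq nat)) -> bool :=
  all (fun q => (size q <= N) && all (fun r => size r <= N) q).
pose I l (s : state) := ok l /\ exists F i, [/\ data F n (size Q) s,
  F ++ edges_from i [seq hedge_edges q | q <- l] = goal,
  inp s = flatten [seq code_hedge q | q <- l] & s VAR xh = i].
have [||b [_ [F [i [dF eF _ _]]]]] := @iter_list N _ parse_hedge I _ Q s1.
- move=> q l u [/andP [/andP [le_q all_q] all_l] [F [i [dF eF inpF hF]]]].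
  have [b' d' i' h'] := parse_hedge_ok N0 dF inpF hF le_q all_q.
  split=> //; split=> //; exists (F ++ numbered i (hedge_edges q)), i.+1; split=> //.
  by rewrite -catA.
- by split=> //; exists [::], 0.
rewrite cats0 in eF; rewrite v1 -/goal -eF; split=> //.
Qed.

Fixpoint silent (c : cmd) : bool :=
  match c with
  | Output _ => false
  | Seq c1 c2 => silent c1 && silent c2
  | Loop _ c => silent c
  | _ => true
  end.

Lemma silentP c s : silent c -> outp (eval c s) = outp s.
Proof.
elim: c s => [A e1 e2|x|e|c1 IH1 c2 IH2|e c IH] s //=.
  by case/andP=> s1 s2; rewrite eval_Seq IH2 // IH1.
by move=> sc; rewrite eval_Loop; elim: (value s e) => //= k <-; apply: IH.
Qed.

Lemma cut_hedge_cons (T : eqType) (g : nat -> T) es H k i :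
  cut_hedge (edges_from k (es :: H)) g i =
    (k == i) && cut g es || cut_hedge (edges_from k.+1 H) g i.
Proof.
rewrite /cut_hedge has_cat has_map; congr (_ || _).
case: eqP => [->|/eqP ne]; first by apply: eq_has => uv /=; rewrite eqxx.
by apply/hasP => -[uv _ /=]; rewrite (negbTE ne).
Qed.

Lemma cut_hedge_lt (T : eqType) (g : nat -> T) H i k : i < k ->
  cut_hedge (edges_from k H) g i = false.
Proof.
elim: H k => // es H IH k lt_i; rewrite cut_hedge_cons gtn_eqF //=.
exact/IH/leqW.
Qed.

Lemma cut_hedge_edges (T : eqType) (g : nat -> T) H i k : i < size H ->
  cut_hedge (edges_from k H) g (k + i) = cut g (nth [::] H i).
Proof.
elim: H i k => // es H IH [|i] k lt_i; rewrite cut_hedge_cons.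
  by rewrite addn0 eqxx cut_hedge_lt ?orbF.
by rewrite -addSnnS IH // ltn_eqF // ltnS leq_addr.
Qed.

Lemma ncut_edges (T : eqType) (g : nat -> T) H :
  ncut (edges_from 0 H) (size H) g = count (cut g) H.
Proof.
rewrite -[in RHS](mkseq_nth [::] H) /mkseq count_map /ncut.
apply: eq_in_count => i; rewrite mem_iota => lt_i.
by rewrite -[i in LHS]add0n cut_hedge_edges.
Qed.

Lemma size_edges_from k H : size (edges_from k H) = \sum_(es <- H) size es.
Proof.
elim: H k => [|es H IH] k /=; first by rewrite big_nil.
by rewrite size_cat size_map IH big_cons.
Qed.

Lemma all_edges_from (p : nat -> nat -> bool) k H :
  all (all (fun uv => p uv.1 uv.2)) H ->
  all (fun t => p t.2.1 t.2.2) (edges_from k H).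
Proof.
by elim: H k => //= es H IH k /andP [pe pH]; rewrite all_cat all_map pe IH.
Qed.

Lemma program_ok N n (Q : seq (seq (seq nat))) :
  let H := [seq hedge_edges q | q <- Q] in
  let s := start (n :: code_hedges Q) in
  size Q + \sum_(es <- H) size es + 2 <= N ->
  all (fun q => (size q <= N) && all (fun r => size r <= N) q) Q ->
  all (all (fun uv => (uv.1 < n) && (uv.2 < n))) H ->
  loops_bounded N program_text s /\
  exists b, outp (eval program_text s) = (if 1 < n then [:: 1; b] else [:: 0]) /\
    (1 < n -> (exists2 f : nat -> nat, 1 < classes n f &
                  count (cut f) H %/ (classes n f - 1) <= b) /\
      forall (T : eqType) (g : nat -> T), b * (classes n g - 1) <= count (cut g) H).
Proof.
move=> H s le_N all_N all_n.
have N0 : 0 < N by lia.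
have le_Q : size Q <= N by lia.
have [b1 d1 L1] := parse_ok n N0 le_Q all_N; rewrite -/s -/H in b1 d1 L1.
set s1 := eval parse s in d1 L1.
have sH : size Q = size H by rewrite size_map.
rewrite /program_text 2!eval_Seq eval_When -/s1.
set s2 := eval (Output _) s1.
have d2 : data (edges_from 0 H) n (size Q) s2 by apply: data_eval d1.
have n2 : s2 VAR xn = n := data_n d2.
have L2 j : s2 LOAD j = 0 by rewrite keeps_arrayP.
have o2 : outp s2 = [:: 1 - (2 - n)].
  rewrite /s2 /= (data_n d1); rewrite (_ : outp s1 = [::]) //.
  by rewrite silentP.
have b3 : loops_bounded N optimize s2.
  split=> //; split=> //.
  apply: (@loops_overP _ [:: xm; xM; xZ]) => // x.
  have dm := data_m d2; have dM := data_M d2; rewrite size_edges_from in dM.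
  by rewrite !inE => /or3P [] /eqP -> /=; rewrite ?dm ?dM; lia.
split.
  have bw : loops_bounded N
      (When (Minus (var xn) (Cst 1)) (optimize ;; Output (var xbest))) s2.
    by apply: bounded_When => // _; exact: (conj b3 Logic.I).
  exact: (conj b1 (conj Logic.I bw)).
exists (eval optimize s2 VAR xbest).
have -> : (0 < value s2 (Minus (var xn) (Cst 1))) = (1 < n) by rewrite /= n2 subn_gt0.
case: ltnP => [n1|n1]; last first.
  by rewrite o2; split=> //; congr [:: _]; lia.
have E_lt := all_edges_from (p := fun u v => (u < n) && (v < n)) 0 all_n.
have [[f [f1 at_f]] opt] := optimize_ok n1 E_lt d2 L2.
split.
  rewrite eval_Seq /= silentP // o2 /=; congr [:: _; _]; lia.
move=> _; split; first by exists f => //; move: at_f; rewrite sH ncut_edges.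
by move=> T g; rewrite -ncut_edges -sH; apply: opt.
Qed.

(** * Hedgegraphs *)

(** If two vertices have different labels, one of them differs from the center. *)
Lemma cut_star (T : eqType) (g : nat -> T) (r : seq nat) :
  reflect (exists u v, [/\ u \in r, v \in r & g u != g v]) (cut g (star r)).
Proof.
apply: (iffP hasP) => [[uv]|[u [v [ur vr ne]]]].
  case: r => // x r /mapP [y yr ->] /= ne; exists x, y.
  by rewrite !inE eqxx yr orbT.
case: r ur vr => // x r ur vr.
suff [y yr ny] : exists2 y, y \in r & g x != g y by exists (x, y) => //; apply: map_f.
move: ur vr ne; rewrite !inE => /predU1P [->|ur] /predU1P [->|vr] ne.
- by rewrite eqxx in ne.
- by exists v.
- by exists u => //; rewrite eq_sym.
- by case: (eqVneq (g x) (g u)) => [e|]; [exists v; rewrite ?e|exists u].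
Qed.

Section Bridge.
Variables (V : finType) (G : hedgegraph V) (nu : V -> 'I_#|V|).
Hypothesis nu_inj : injective nu.

Definition hyperedge_code (s : seq V) : seq nat := [seq val (nu v) | v <- s].

Definition levels (T : eqType) (g : nat -> T) : {set {set V}} :=
  preim_partition (fun v => g (nu v)) [set: V].

Lemma mem_iota_nu i : i < #|V| -> exists v, val (nu v) = i.
Proof.
move=> lt_i; have := inj_card_onto nu_inj _ (Ordinal lt_i).
rewrite card_ord => /(_ (leqnn _)) /codomP [v e].
by exists v; rewrite -e.
Qed.

Lemma card_levels (T : eqType) (g : nat -> T) : #|levels g| = classes #|V| g.
Proof.
pose s := [seq [set v | g (nu v) == y] | y <- undup [seq g i | i <- iota 0 #|V|]].
have : uniq s.
  rewrite map_inj_in_uniq ?undup_uniq // => y z; rewrite !mem_undup.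
  move=> /mapP [i + ->] /mapP [j + ->]; rewrite !mem_iota => /mem_iota_nu [v <-] _.
  by move=> /setP /(_ v); rewrite !inE eqxx => /esym/eqP.
rewrite /classes -(size_map (fun y => [set v | g (nu v) == y])) -/s => /card_uniqP <-.
apply: eq_card => B; apply/imsetP/mapP => [[x _ ->]|[z]].
  exists (g (nu x)); first by rewrite mem_classes.
  by apply/setP => y; rewrite !inE eq_sym.
rewrite mem_undup => /mapP [i]; rewrite mem_iota => /mem_iota_nu [v <-] -> ->.
by exists v => //; apply/setP => y; rewrite !inE eq_sym.
Qed.

Lemma crosses_levels (T : eqType) (g : nat -> T) (h : {set V}) s :
  perm_eq s (enum h) -> crosses (levels g) h = cut g (star (hyperedge_code s)).
Proof.
move=> perm_s; apply/card_gt1P/cut_star => [[B [C []]]|[i [j []]]].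
  rewrite !inE => /andP [/imsetP [x _ ->] /set0Pn [u hu]].
  move=> /andP [/imsetP [y _ ->] /set0Pn [v hv]].
  move: hu hv; rewrite !inE => /andP [hu /eqP gu] /andP [hv /eqP gv] ne.
  exists (val (nu u)), (val (nu v)).
  rewrite !(map_f (fun v => val (nu v))) ?(perm_mem perm_s) ?mem_enum //; split=> //.
  apply: contra ne => /eqP e; apply/eqP/setP => z; rewrite !inE.
  by rewrite gu gv e.
move=> /mapP [u hu ->] /mapP [v hv ->] ne.
rewrite !(perm_mem perm_s) !mem_enum in hu hv.
exists [set y in [set: V] | g (nu u) == g (nu y)].
exists [set y in [set: V] | g (nu v) == g (nu y)].
split.
- by rewrite inE imset_f //; apply/set0Pn; exists u; rewrite !inE hu eqxx.
- by rewrite inE imset_f //; apply/set0Pn; exists v; rewrite !inE hv eqxx.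
- by apply: contra ne => /eqP /setP /(_ v); rewrite !inE eqxx => /eqP ->.
Qed.

Definition hedge_code (es : seq {set V}) (vs : {set V} -> seq V) : seq (seq nat) :=
  [seq hyperedge_code (vs h) | h <- es].

Lemma cut_hedge_edges_has (T : eqType) (g : nat -> T) q :
  cut g (hedge_edges q) = has (fun r => cut g (star r)) q.
Proof. by elim: q => //= r q <-; rewrite /cut has_cat. Qed.

Lemma cut_hedge_code (T : eqType) (g : nat -> T) (e : {set {set V}})
    (es : seq {set V}) (vs : {set V} -> seq V) :
  perm_eq es (enum e) -> {in e, forall h, perm_eq (vs h) (enum h)} ->
  cut g (hedge_edges (hedge_code es vs)) = [exists h in e, crosses (levels g) h].
Proof.
move=> perm_es perm_vs; rewrite cut_hedge_edges_has has_map.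
apply/hasP/exists_inP => [[h hes]|[h he]].
  rewrite (perm_mem perm_es) mem_enum in hes => /= ch; exists h => //.
  by rewrite (crosses_levels _ (perm_vs _ hes)).
rewrite (crosses_levels _ (perm_vs _ he)) => ch; exists h => //.
by rewrite (perm_mem perm_es) mem_enum.
Qed.

(** The orders chosen by the code: of the hedges, of the hyperedges in each hedge, and of the
    vertices in each hyperedge. *)
Variables (hs : seq {set {set V}}) (es : {set {set V}} -> seq {set V}).
Variable vs : {set {set V}} -> {set V} -> seq V.
Hypothesis perm_hs : perm_eq hs (enum (hedges G)).
Hypothesis perm_es : {in hedges G, forall e, perm_eq (es e) (enum e)}.
Hypothesis perm_vs : forall e h, e \in hedges G -> h \in e ->
  perm_eq (vs e h) (enum h).

Let Q := [seq hedge_code (es e) (vs e) | e <- hs].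
Let H := [seq hedge_edges q | q <- Q].

Lemma mem_hs e : (e \in hs) = (e \in hedges G).
Proof. by rewrite (perm_mem perm_hs) mem_enum. Qed.

Lemma card_delta_levels (T : eqType) (g : nat -> T) :
  #|delta G (levels g)| = count (cut g) H.
Proof.
rewrite !count_map -sum1_count (perm_big _ perm_hs) big_enum_cond /= -sum1_card.
apply: eq_big => // e; rewrite inE; case: (boolP (e \in _)) => //= he.
by rewrite (cut_hedge_code _ (perm_es he) (fun h => perm_vs he)).
Qed.

Lemma levels_partition (T : eqType) (g : nat -> T) : partition (levels g) [set: V].
Proof. exact: preim_partitionP. Qed.

Lemma partition_levels (P : {set {set V}}) : partition P [set: V] ->
  exists g : nat -> {set V}, P = levels g.
Proof.
move=> part_P.
(* A vertex is labeled by its own part; [set0] is a default for numbers of no vertex. *)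
pose g i := if [pick v | val (nu v) == i] is Some v then pblock P v else set0.
exists g; rewrite -[LHS](preim_partition_pblock part_P).
suff e : (fun v => g (nu v)) =1 pblock P.
  by apply: eq_in_imset => x _; apply/setP => y; rewrite !inE -!e.
move=> v; rewrite /g; case: pickP => [u /eqP/val_inj/nu_inj -> //|/(_ v)].
by rewrite eqxx.
Qed.

Lemma all_edges_lt : all (all (fun uv => (uv.1 < #|V|) && (uv.2 < #|V|))) H.
Proof.
apply/allP => _ /mapP [_ /mapP [e _ ->] ->].
apply/allP => uv /flatten_mapP [_ /mapP [h _ ->]].
by case: (vs e h) => //= x s /mapP [_ /mapP [y _ ->] ->] /=; rewrite !ltn_ord.
Qed.

(** * Bounds in terms of the input size *)

Lemma sum_hyperedges (F : {set V} -> nat) :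
  \sum_(e in hedges G) \sum_(h in e) F h = \sum_(h in cover (hedges G)) F h.
Proof. by rewrite big_trivIset ?hedges_disjoint. Qed.

(** Only the empty set contributes 0 to the sum, and it occurs at most once. *)
Lemma card_set_of_sets (T : finType) (A : {set {set T}}) :
  #|A| <= (\sum_(B in A) #|B|).+1.
Proof.
rewrite -sum1_card; have [A0|nA0] := boolP (set0 \in A).
  rewrite (bigD1 set0) //= [X in _ <= X.+1](bigD1 set0) //= cards0 ltnS.
  by apply: leq_sum => B /andP [_]; rewrite -card_gt0.
apply: leqW; apply: leq_sum => B BA; rewrite card_gt0.
by apply: contraNneq nA0 => <-.
Qed.

(** As no hyperedge lies in two hedges, the left side counts distinct hyperedges, of which at most
    one is empty. *)
Lemma card_hyperedges_le : \sum_(e in hedges G) #|e| <= (input_size G).+1.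
Proof.
rewrite /input_size sum_hyperedges.
under eq_bigr do rewrite -sum1_card; rewrite sum_hyperedges sum1_card.
exact: card_set_of_sets.
Qed.

Lemma card_hedges_le : #|hedges G| <= (input_size G).+2.
Proof. by apply: leq_trans (card_set_of_sets _) _; rewrite ltnS card_hyperedges_le. Qed.

Lemma size_hedge_edges (q : seq (seq nat)) :
  size (hedge_edges q) <= \sum_(r <- q) size r.
Proof.
elim: q => //= r q IH; rewrite big_cons /hedge_edges /= size_cat leq_add //.
by case: r => //= x r; rewrite size_map.
Qed.

Lemma sum_hedge_edges_le : \sum_(es <- H) size es <= input_size G.
Proof.
rewrite !big_map (perm_big _ perm_hs) big_enum; apply: leq_sum => e he.
apply: leq_trans (size_hedge_edges _) _; rewrite big_map (perm_big _ (perm_es he)) big_enum.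
by apply: leq_sum => h hh; rewrite size_map (perm_size (perm_vs he hh)) -cardE.
Qed.

Lemma all_sizes_le N : (input_size G).+1 <= N ->
  all (fun q => (size q <= N) && all (fun r => size r <= N) q) Q.
Proof.
move=> le_N; apply/allP => _ /mapP [e + ->]; rewrite mem_hs => he.
apply/andP; split.
  rewrite size_map (perm_size (perm_es he)) -cardE.
  apply: leq_trans le_N; apply: leq_trans card_hyperedges_le.
  by rewrite (bigD1 e) //= leq_addr.
apply/allP => _ /mapP [h + ->]; rewrite (perm_mem (perm_es he)) mem_enum => hh.
rewrite size_map (perm_size (perm_vs he hh)) -cardE.
apply: leq_trans le_N; apply: leqW; rewrite /input_size (bigD1 e) //= (bigD1 h) //=.
by rewrite -addnA leq_addr.
Qed.

(** The levels of [f] are a partition of ratio at most [b]. Conversely every partition consists of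
    the levels of some [g], and for c > 1 the bound b (c - 1) <= d is equivalent to b <= floor(d /
    (c - 1)), so that the floor loses nothing. *)
Lemma connectivity_eq b (f : nat -> nat) : 1 < classes #|V| f ->
  count (cut f) H %/ (classes #|V| f - 1) <= b ->
  (forall (T : eqType) (g : nat -> T), b * (classes #|V| g - 1) <= count (cut g) H) ->
  partition_connectivity G = Some b.
Proof.
move=> f1 le_b opt.
have lb P k : partition P [set: V] -> partition_ratio G P = Some k -> b <= k.
  move=> /partition_levels [g ->]; rewrite /partition_ratio card_levels card_delta_levels.
  case: eqP => // /eqP; rewrite -lt0n => c0 [<-].
  by rewrite leq_divRL.
have lbs k : partition_connectivity G = Some k -> b <= k.
  rewrite /partition_connectivity; elim/big_ind: _ k => //.
  - move=> [x|] [y|] hx hy k //=.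
    + by case=> <-; rewrite leq_min hx // hy.
    + exact: hx.
    + exact: hy.
  - by move=> P /lb h k /h.
have : exists2 k, partition_connectivity G = Some k & k <= b.
  have lt0 : (classes #|V| f - 1 == 0) = false by rewrite subn_eq0 leqNgt f1.
  rewrite /partition_connectivity (bigD1 (levels f)) ?levels_partition //=.
  rewrite {1}/partition_ratio card_levels lt0 card_delta_levels.
  case: (\big[_/_]_(_ | _) _) => [y|]; last by eexists; [reflexivity|].
  by eexists; [reflexivity|]; apply: leq_trans le_b; rewrite geq_minl.
by case=> k e le_k; rewrite e; congr Some; apply/eqP; rewrite eqn_leq le_k lbs.
Qed.

Lemma connectivity_trivial : #|V| <= 1 -> partition_connectivity G = None.
Proof.
move=> V1; rewrite /partition_connectivity big1 // => P /partition_levels [g ->].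
rewrite /partition_ratio card_levels; case: eqP => // /eqP.
by rewrite subn_eq0 (leq_trans (classes_le _ _)).
Qed.

End Bridge.

(** * Decoding the input *)

Lemma encodes_set_choice (T : finType) (U : Type) (u0 : U)
    (encT : T -> seq nat -> Prop) (R : T -> U -> Prop) (code : U -> seq nat)
    (A : {set T}) (w : seq nat) :
  (forall x v, x \in A -> encT x v -> exists2 y, R x y & v = code y) ->
  encodes_set encT A w ->
  exists s (F : T -> U), [/\ perm_eq s (enum A), {in A, forall x, R x (F x)}
    & w = size s :: flatten [seq code (F x) | x <- s]].
Proof.
move=> dec [s [f [perm_s enc_f ->]]].
(* The decodings of the members are chosen simultaneously, with the default [u0] outside [A]. *)
have /fin_all_exists [F RF] x : exists y, x \in A -> R x y /\ f x = code y.
  have [xA|] := boolP (x \in A); last by exists u0.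
  by have [y Rxy e] := dec _ _ xA (enc_f _ xA); exists y.
exists s, F; split=> // [x /RF [] //|]; congr (_ :: flatten _).
by apply/eq_in_map => x; rewrite (perm_mem perm_s) mem_enum => /RF [].
Qed.

Section Decode.
Variables (V : finType) (nu : V -> 'I_#|V|).

Lemma decode_hyperedge (h : {set V}) w : encodes_set (encodes_vertex nu) h w ->
  exists2 t, perm_eq t (enum h) & w = code_hyperedge (hyperedge_code nu t).
Proof.
case=> t [f [perm_t enc_f ->]]; exists t => //.
rewrite /code_hyperedge size_map; congr (_ :: _).
rewrite -[hyperedge_code _ _]flatten_seq1 -map_comp; congr flatten.
by apply/eq_in_map => x; rewrite (perm_mem perm_t) mem_enum => /enc_f.
Qed.

Lemma decode_hedge (e : {set {set V}}) w :
  encodes_set (encodes_set (encodes_vertex nu)) e w ->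
  exists2 p : seq {set V} * ({set V} -> seq V),
    perm_eq p.1 (enum e) /\ {in e, forall h, perm_eq (p.2 h) (enum h)}
    & w = code_hedge (hedge_code nu p.1 p.2).
Proof.
move=> /(encodes_set_choice [::] (R := fun (h : {set V}) t => perm_eq t (enum h))
  (code := fun t => code_hyperedge (hyperedge_code nu t))).
case=> [h v _ /decode_hyperedge //|s [F [perm_s RF ->]]].
by exists (s, F); rewrite // /code_hedge size_map -map_comp.
Qed.

Lemma decode (G : hedgegraph V) u :
  encodes_set (encodes_set (encodes_set (encodes_vertex nu))) (hedges G) u ->
  exists (hs : seq {set {set V}}) es vs, [/\ perm_eq hs (enum (hedges G)),
    {in hedges G, forall e : {set {set V}}, perm_eq (es e) (enum e)},
    forall e h, e \in hedges G -> h \in e -> perm_eq (vs e h) (enum h)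
    & u = code_hedges [seq hedge_code nu (es e) (vs e) | e <- hs]].
Proof.
move=> /(encodes_set_choice ([::], fun=> [::])
  (R := fun (e : {set {set V}}) (p : seq {set V} * ({set V} -> seq V)) =>
    perm_eq p.1 (enum e) /\ {in e, forall h : {set V}, perm_eq (p.2 h) (enum h)})
  (code := fun p => code_hedge (hedge_code nu p.1 p.2))).
case=> [h v _ /decode_hedge //|s [F [perm_s RF ->]]].
exists s, (fun e => (F e).1), (fun e => (F e).2); split=> //.
- by move=> e /RF [].
- by move=> e h /RF [_ pv] /pv.
- by rewrite /code_hedges size_map -map_comp.
Qed.
End Decode.

(** Brings the running time into the form c p^k + c; the additive term takes care of p = 0. *)
Lemma expn_affine_le (a b p k : nat) :
  (a * p + b) ^ k <= (a + b) ^ k * p ^ k + (a + b) ^ k.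
Proof.
case: k => [|k]; first by rewrite !expn0.
case: (posnP p) => [->|p0].
  by rewrite muln0 add0n; apply: leq_trans (leq_addl _ _); rewrite leq_exp2r ?leq_addl.
apply: leq_trans (leq_addr _ _); rewrite -expnMn leq_exp2r // mulnDl leq_add2l.
exact: leq_pmulr.
Qed.

Theorem theorem1p1 :
  exists (A : program) (c k : nat),
    forall (V : finType) (G : hedgegraph V) (w : seq nat),
      encodes G w ->
      computes_within A w (c * input_size G ^ k + c)
        (encode_value (partition_connectivity G)).
Proof.
(* The base 7 is 2 + 5, from the loop bound [N.+1 = 2 * p + 5]. *)
exists (compile 0 0 program_text), (weight program_text * 7 ^ depth program_text).
exists (depth program_text) => V G w [nu [u [nu_inj /decode dec ->]]].
have [hs [es [vs [perm_hs perm_es perm_vs ->]]]] := dec.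
set Q := [seq _ | e <- hs]; set p := input_size G.
(* At most p + 2 hedges, at most p edges, and the 2 in the definition of Z. *)
pose N := 2 * p + 4.
have le_N : size Q + \sum_(es <- [seq hedge_edges q | q <- Q]) size es + 2 <= N.
  have := card_hedges_le G; have := sum_hedge_edges_le nu perm_hs perm_es perm_vs.
  have -> : size Q = #|hedges G| by rewrite size_map (perm_size perm_hs) -cardE.
  by rewrite -/Q -/p /N; lia.
have all_N : all (fun q => (size q <= N) && all (fun r => size r <= N) q) Q.
  apply: (all_sizes_le nu perm_hs perm_es perm_vs).
  by rewrite -/p /N; lia.
have [bN [b [out_b b_opt]]] := program_ok le_N all_N (all_edges_lt nu hs es vs).
apply: (@computes_within_leq _ _ (weight program_text * N.+1 ^ depth program_text)).
  have := expn_affine_le 2 5 p (depth program_text).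
  rewrite -[N.+1]/(2 * p + 4).+1 -addnS.
  move: (_ ^ _) (7 ^ _) (p ^ _) (weight _) => x y z a le_x.
  by rewrite -mulnA -mulnDr leq_mul2l le_x orbT.
have <- : outp (eval program_text (start (#|V| :: code_hedges Q))) =
    encode_value (partition_connectivity G).
  rewrite out_b; case: ltnP => [V1|V1]; last by rewrite (connectivity_trivial G nu_inj V1).
  have [[f f1 le_b] opt] := b_opt V1.
  by rewrite (connectivity_eq nu_inj perm_hs perm_es perm_vs f1 le_b opt).
exact: compile_program.
Qed.
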